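(* Let $\phi\in\Gamma_0(\mathbb{R}^m)$ be Legendre with $\operatorname{dom}\phi=\mathbb{R}^m$ and let $f:\mathbb{R}^m\to\overline{\mathbb{R}}$ be proper, lsc and right prox-bounded relative to $\phi$ with threshold $\lambda_f$. For $\bar x\in\operatorname{dom}f$ let $f\circ\nabla\phi^*$ be prox-regular relative to $\phi^*$ at $\nabla\phi(\bar x)$ for $\bar v\in\partial(f\circ\nabla\phi^* )(\nabla\phi(\bar x))$. If $\lambda\in\,]0,\lambda_f[$ is sufficiently small, then $\overrightarrow{\operatorname{env}}^{\phi}_{\lambda}f$ is $\mathcal{C}^1$ around $\bar y=\bar x+\lambda\bar v$ with $$\nabla\overrightarrow{\operatorname{env}}^{\phi}_{\lambda}f(y)=\frac1\lambda\big(\nabla\phi(y)-\nabla\phi(\overrightarrow{\operatorname{prox}}^{\phi}_{\lambda}f(y))\big)=\frac1\lambda\big(\nabla\phi(y)-\overleftarrow{\operatorname{prox}}^{\phi^*}_{\lambda}(f\circ\nabla\phi^* )(\nabla\phi(y))\big)$$ for $y$ sufficiently close to $\bar y$. If, furthermore, $\phi$ is very strictly convex, then $\nabla\overrightarrow{\operatorname{env}}^{\phi}_{\lambda}f$ is Lipschitz continuous on a neighborhood of $\bar y$.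
   Context: $\overline{\mathbb{R}}=\mathbb{R}\cup\{-\infty,\infty\}$; $\Gamma_0(\mathbb{R}^m)$ is the set of proper lsc convex functions $\mathbb{R}^m\to\overline{\mathbb{R}}$. $\phi\in\Gamma_0(\mathbb{R}^m)$ is Legendre if it is essentially smooth ($\operatorname{int}(\operatorname{dom}\phi)\neq\emptyset$, $\phi$ is differentiable on $\operatorname{int}(\operatorname{dom}\phi)$, and $\|\nabla\phi(x^\nu)\|\to\infty$ whenever $x^\nu\to x\in\operatorname{bdry}\operatorname{dom}\phi$) and essentially strictly convex (strictly convex on every convex subset of $\operatorname{dom}\partial\phi$). Then the convex conjugate $\phi^*$ is also Legendre, and $\nabla\phi:\operatorname{int}(\operatorname{dom}\phi)\to\operatorname{int}(\operatorname{dom}\phi^* )$ is a bijection with inverse $\nabla\phi^*$. The composition $f\circ\nabla\phi^*$ is understood as $+\infty$ outside $\operatorname{int}(\operatorname{dom}\phi^* )$. Very strictly convex: $\phi$ is $\mathcal{C}^2$ on $\operatorname{int}(\operatorname{dom}\phi)\ne\emptyset$ with positive definite $\nabla^2\phi(x)$ for all $x\in\operatorname{int}(\operatorname{dom}\phi)$. For a Legendre function $\psi$: $D_\psi(x,y)=\psi(x)-\psi(y)-\langle\nabla\psi(y),x-y\rangle$ if $y\in\operatorname{int}(\operatorname{dom}\psi)$, $+\infty$ otherwise. For $\lambda>0$ and proper $h$ (infima and argmin over $x\in\mathbb{R}^m$): left prox $\overleftarrow{\operatorname{prox}}^{\psi}_{\lambda}h(y)=\operatorname{argmin}_x h(x)+\frac1\lambda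 D_\psi(x,y)$; right envelope $\overrightarrow{\operatorname{env}}^{\psi}_{\lambda}h(y)=\inf_x h(x)+\frac1\lambda D_\psi(y,x)$; right prox $\overrightarrow{\operatorname{prox}}^{\psi}_{\lambda}h(y)=\operatorname{argmin}_x h(x)+\frac1\lambda D_\psi(y,x)$. The gradient formula includes the assertion that the prox mappings are single-valued at the points concerned (and are identified with their single elements). $f$ with $\operatorname{int}(\operatorname{dom}\phi)\cap\operatorname{dom}f\ne\emptyset$ is right prox-bounded relative to $\phi$ if there is $\lambda>0$ with $\overrightarrow{\operatorname{env}}^{\phi}_{\lambda}f(y)>-\infty$ for some $y\in\operatorname{int}(\operatorname{dom}\phi)$; the threshold $\lambda_f$ is the supremum of all such $\lambda$. $\partial$ is the limiting (Mordukhovich) subdifferential. $h$ is locally lsc at $\bar z$ (where $h$ is finite) if there is $\epsilon>0$ such that all sets $\{z:\|z-\bar z\|\le\epsilon,\ h(z)\le\alpha\}$ with $\alpha\le h(\bar z)+\epsilon$ are closed. $h$ is prox-regular relative to a Legendre function $\psi$ at $\bar z\in\operatorname{int}(\operatorname{dom}\psi)$ for $\bar v$ if $h$ is finite and locally lsc at $\bar z$, $\bar v\in\partial h(\bar z)$, and there exist $\epsilon>0$, $r\ge0$ such that for all $\|z'-\bar z\|<\epsilon$, $\|z-\bar z\|<\epsilon$ (with $\epsilon$ sufficiently small that $z,z'\in\operatorname{int}(\operatorname{dom}\psi)$), $h(z')\ge h(z)+\langle v,z'-z\rangle-rD_\psi(z',z)$ whenever $h(z)-h(\bar z)<\epsilon$,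 $v\in\partial h(z)$, $\|v-\bar v\|<\epsilon$. *)

(* Defs.v *)
From HB Require Import structures.
From mathcomp Require Import all_boot all_order all_algebra.
From mathcomp Require Import all_classical all_reals all_analysis.
Set Implicit Arguments.
Unset Strict Implicit.
Unset Printing Implicit Defensive.
Import Order.TTheory GRing.Theory Num.Theory.
Import numFieldNormedType.Exports.
Local Open Scope classical_set_scope.
Local Open Scope ring_scope.

(* R^m is 'rV[R]_m.  Its library topology is the usual one, but its library
   norm is the sup norm, hence the Euclidean norm below. *)

Section Euclidean.
Context {R : realType} {m : nat}.
Implicit Types u v : 'rV[R]_m.

Definition dot u v : R := (u *m v^T) 0 0.

Definition enorm u : R := Num.sqrt (dot u u).

Definition bdry (A : set 'rV[R]_m) : set 'rV[R]_m := closure A `\` A°.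

End Euclidean.

Section ExtendedRealFunctions.
Context {R : realType} {m : nat}.
Implicit Types (g h : 'rV[R]_m -> \bar R) (x y : 'rV[R]_m).

Definition edom g : set 'rV[R]_m := [set x | (g x < +oo)%E].

Definition eproper g : Prop := edom g !=set0 /\ forall x, (-oo < g x)%E.

Definition econvex g : Prop := forall x y (t : R), 0 < t < 1 ->
  (g (t *: x + (1 - t) *: y)%R <= t%:E * g x + (1 - t)%R%:E * g y)%E.

Definition strictly_convex_on (C : set 'rV[R]_m) g : Prop :=
  forall x y (t : R), C x -> C y -> x != y -> 0 < t < 1 ->
  (g (t *: x + (1 - t) *: y)%R < t%:E * g x + (1 - t)%R%:E * g y)%E.

Definition gamma0 g : Prop :=
  [/\ eproper g, lower_semicontinuous g & econvex g].

(* The finiteness condition is needed because [fine] maps +oo and -oo to 0. *)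
Definition ediff g x : Prop :=
  (\forall y \near x, g y \is a fin_num) /\ differentiable (fine \o g) x.

Definition grad g x : 'rV[R]_m :=
  \row_i 'd (fine \o g) x (delta_mx 0 i).

Definition hess g x : 'M[R]_m := 'J (grad g) x.

(* h y >= h x + <v, y - x> + o(|y - x|), as in Rockafellar and Wets,
   Variational Analysis, Definition 8.3 *)
Definition regular_subdiff h x : set 'rV[R]_m := [set v |
  h x \is a fin_num /\
  forall e : R, 0 < e -> \forall y \near x,
    (h x + (dot v (y - x) - e * enorm (y - x))%R%:E <= h y)%E].

Definition limiting_subdiff h x : set 'rV[R]_m := [set v |
  h x \is a fin_num /\
  exists (xn vn : nat -> 'rV[R]_m),
    [/\ xn @ \oo --> x, h (xn n) @[n --> \oo] --> h x,
        (forall n, regular_subdiff h (xn n) (vn n)) & vn @ \oo --> v]].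

Definition essentially_smooth g : Prop :=
  [/\ (edom g)° !=set0,
      (forall x, (edom g)° x -> ediff g x) &
      forall (xn : nat -> 'rV[R]_m) x,
        (forall n, (edom g)° (xn n)) -> xn @ \oo --> x -> bdry (edom g) x ->
        enorm (grad g (xn n)) @[n --> \oo] --> +oo].

Definition essentially_strictly_convex g : Prop :=
  forall C : set (convex_lmodType 'rV[R]_m), convex_set C ->
    C `<=` [set x | limiting_subdiff g x !=set0] -> strictly_convex_on C g.

Definition legendre g : Prop :=
  [/\ gamma0 g, essentially_smooth g & essentially_strictly_convex g].

(* Second-order smoothness on int (dom g): both the function and its gradient
   are differentiable, and the Hessian is continuous. *)
Definition very_strictly_convex g : Prop :=
  (edom g)° !=set0 /\
  forall x, (edom g)° x ->
    [/\ ediff g x, differentiable (grad g) x, {for x, continuous (hess g)} &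
        forall w : 'rV[R]_m, w != 0 -> 0 < dot (w *m hess g x) w].

Definition convex_conj g : 'rV[R]_m -> \bar R := fun v =>
  ereal_sup (range (fun x => ((dot v x)%:E - g x)%E)).

Definition comp_grad_conj h g : 'rV[R]_m -> \bar R := fun z =>
  if `[< (edom (convex_conj g))° z >] then h (grad (convex_conj g) z) else +oo%E.

Definition bregman g x y : \bar R :=
  if `[< (edom g)° y >] then (g x - g y - (dot (grad g y) (x - y)%R)%:E)%E
  else +oo%E.

(* Finiteness from above encodes the convention that the argmin of the
   constant function +oo is empty. *)
Definition argmin g : set 'rV[R]_m :=
  [set x | (g x < +oo)%E /\ g x = ereal_inf (range g)].

Definition left_prox g (l : R) h y : set 'rV[R]_m :=
  argmin (fun x => (h x + (l^-1)%:E * bregman g x y)%E).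

Definition right_env g (l : R) h : 'rV[R]_m -> \bar R := fun y =>
  ereal_inf (range (fun x => (h x + (l^-1)%:E * bregman g y x)%E)).

Definition right_prox g (l : R) h y : set 'rV[R]_m :=
  argmin (fun x => (h x + (l^-1)%:E * bregman g y x)%E).

Definition prox_bound_params g h : set R := [set l | 0 < l /\
  exists2 y, (edom g)° y & (-oo < right_env g l h y)%E].

Definition right_prox_bounded g h : Prop :=
  ((edom g)° `&` edom h !=set0) /\ prox_bound_params g h !=set0.

Definition prox_threshold g h : \bar R :=
  ereal_sup (EFin @` prox_bound_params g h).

Definition locally_lsc h x : Prop :=
  exists2 e : R, 0 < e & forall a : R, (a%:E <= h x + e%:E)%E ->
    closed [set z | enorm (z - x) <= e /\ (h z <= a%:E)%E].

Definition prox_regular g h x v : Prop :=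
  [/\ (edom g)° x, h x \is a fin_num, locally_lsc h x,
      limiting_subdiff h x v &
  exists e r : R, [/\ 0 < e, 0 <= r,
    (forall z : 'rV[R]_m, enorm (z - x) < e -> (edom g)° z) &
    forall z' z w : 'rV[R]_m,
      enorm (z' - x) < e -> enorm (z - x) < e ->
      (h z - h x < e%:E)%E -> limiting_subdiff h z w -> enorm (w - v) < e ->
      (h z + (dot w (z' - z)%R)%:E - r%:E * bregman g z' z <= h z')%E]].

Definition C1_around g x : Prop :=
  \forall y \near x, ediff g y /\ {for y, continuous (grad g)}.

Definition lipschitz_around (F : 'rV[R]_m -> 'rV[R]_m) x : Prop :=
  exists2 U, nbhs x U & exists L : R, forall y z, U y -> U z ->
    enorm (F y - F z) <= L * enorm (y - z).

End ExtendedRealFunctions.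

(* Main.v *)
Require Import Defs.
From HB Require Import structures.
From mathcomp Require Import all_boot all_order all_algebra.
From mathcomp Require Import all_classical all_reals all_analysis.
From mathcomp Require Import ring lra.
Import Order.TTheory GRing.Theory Num.Theory.
Import numFieldNormedType.Exports.
Local Open Scope classical_set_scope.
Local Open Scope ring_scope.
Set Implicit Arguments.
Unset Strict Implicit.
Unset Printing Implicit Defensive.

(** Let [P] be the gradient of [phi] and [D] its Bregman distance. Since [phi]
    is finite, differentiable and strictly convex on the whole space, [P] is a
    homeomorphism onto the interior of [dom phi*] with inverse [grad phi*], and
    [D_phi* (P u) (P x) = D x u]. Substituting [z = P x] turns the left proximal
    problem of [f o grad phi*] at [P y] into the right proximal problem
      minimise [f x + D y x / l] over [x],
    so everything can be done with this problem, whose first-order condition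
    at a minimiser [p] is that [(y - p) / l] is a subgradient of
    [f o grad phi*] at [P p].

    The heart of the matter is the growth of the objective at
    [ybar = xbar + l vbar] ([prox_growth]). Near [P xbar] the prox-regularity
    inequality at [P xbar] bounds the objective from below by its value at
    [xbar] plus [(1 / l - r) D xbar x]; away from [P xbar] prox-boundedness,
    with some parameter [l1], leaves at least half of [D xbar x / l] as soon as
    [l <= l1 / 2], up to an error that is linear in [|P x - P xbar|] with a
    coefficient independent of [l]. Since [D xbar x] itself grows linearly in
    [|P x - P xbar|] ([divergence_dual_growth]), for small [l] the objective
    exceeds its value at [xbar] by a multiple of [|P x - P xbar|] outside any
    neighbourhood of [P xbar]. Moving [ybar] to [y] tilts the objective by the
    linear term [- <P x, y - ybar> / l], which the linear growth absorbs.
    Hence for [y] near [ybar] minimisers exist and are close to [xbar], so that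
    prox-regularity applies at all of them. Writing it down at two minimisers
    [p], [p'], for [y], [y'], and adding the two inequalities cancels [f] and
    leaves ([prox_monotone])
      [(1 - l r) <P p' - P p, p' - p> <= <P p' - P p, y' - y>].

    This one inequality gives uniqueness ([y = y']), continuity of
    [y |-> P (prox y)] (by linear growth of [D] again), and, when [phi] is very
    strictly convex, Lipschitz continuity, because then the left-hand side
    dominates a multiple of [|P p' - P p|^2] locally
    ([grad_lipschitz_coercive]). Comparing the two problems at each other's
    minimisers finally squeezes the increment of the envelope between linear
    terms and shows that its gradient is [(P y - P (prox y)) / l]
    ([envelope_has_grad]). *)

(** * Euclidean norm and compactness *)

Lemma addrKl (V : zmodType) (x y : V) : x + y - x = y.
Proof. by rewrite addrAC subrr add0r. Qed.

Section EuclideanSpace.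
Context {R : realType} {m : nat}.
Implicit Types (u v w x y z : 'rV[R]_m) (a : R).

Lemma dotE u v : dot u v = \sum_i u 0 i * v 0 i.
Proof. by rewrite /dot mxE; apply: eq_bigr => i _; rewrite mxE. Qed.

Lemma dotC u v : dot u v = dot v u.
Proof. by rewrite !dotE; apply: eq_bigr => i _; rewrite mulrC. Qed.

Lemma dotDl u v w : dot (u + v) w = dot u w + dot v w.
Proof. by rewrite /dot mulmxDl mxE. Qed.

Lemma dotNl u w : dot (- u) w = - dot u w.
Proof. by rewrite /dot mulNmx mxE. Qed.

Lemma dotBl u v w : dot (u - v) w = dot u w - dot v w.
Proof. by rewrite dotDl dotNl. Qed.

Lemma dotZl a u w : dot (a *: u) w = a * dot u w.
Proof. by rewrite /dot -scalemxAl mxE. Qed.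

Lemma dotDr u v w : dot w (u + v) = dot w u + dot w v.
Proof. by rewrite !(dotC w) dotDl. Qed.

Lemma dotNr u w : dot w (- u) = - dot w u.
Proof. by rewrite !(dotC w) dotNl. Qed.

Lemma dotBr u v w : dot w (u - v) = dot w u - dot w v.
Proof. by rewrite !(dotC w) dotBl. Qed.

Lemma dotZr a u w : dot w (a *: u) = a * dot w u.
Proof. by rewrite !(dotC w) dotZl. Qed.

Lemma dot0l w : dot 0 w = 0.
Proof. by rewrite /dot mul0mx mxE. Qed.

Lemma dot_ge0 u : 0 <= dot u u.
Proof. by rewrite dotE; apply: sumr_ge0 => i _; rewrite -expr2 sqr_ge0. Qed.

Lemma enorm_ge0 u : 0 <= enorm u.
Proof. exact: sqrtr_ge0. Qed.

Lemma enorm_sqr u : enorm u ^+ 2 = dot u u.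
Proof. by rewrite sqr_sqrtr ?dot_ge0. Qed.

Lemma coord_le_enorm u i : `|u 0 i| <= enorm u.
Proof.
rewrite -sqrtr_sqr ler_wsqrtr // dotE (bigD1 i) //= -expr2 lerDl.
by apply: sumr_ge0 => j _; rewrite -expr2 sqr_ge0.
Qed.

Lemma norm_le_enorm u : `|u| <= enorm u.
Proof.
rewrite [leLHS]mx_normrE; apply/bigmax_leP; split; first exact: enorm_ge0.
by case=> i j _ /=; rewrite (ord1 i) coord_le_enorm.
Qed.

Lemma coord_le_norm u i : `|u 0 i| <= `|u|.
Proof.
rewrite [leRHS]mx_normrE.
exact: (le_bigmax _ (fun ij : 'I_1 * 'I_m => `|u ij.1 ij.2|) (0, i)).
Qed.

Lemma enorm_le_norm u : enorm u <= m.+1%:R * `|u|.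
Proof.
rewrite -[leRHS]ger0_norm ?mulr_ge0 // -sqrtr_sqr ler_wsqrtr // dotE.
apply: (@le_trans _ _ (\sum_(i < m) `|u| ^+ 2)).
  apply: ler_sum => i _.
  by rewrite -expr2 -real_normK ?num_real // lerXn2r ?nnegrE // coord_le_norm.
rewrite sumr_const card_ord -[leLHS]mulr_natl exprMn; apply: ler_wpM2r.
  exact: sqr_ge0.
by rewrite -natrX ler_nat expnS (leq_trans (leqnSn m)) // leq_pmulr.
Qed.

Lemma enorm0 : enorm (0 : 'rV[R]_m) = 0.
Proof. by rewrite /enorm dot0l sqrtr0. Qed.

Lemma enorm_eq0 u : (enorm u == 0) = (u == 0).
Proof.
apply/eqP/eqP => [u0|->]; last exact: enorm0.
by apply/eqP; rewrite -normr_le0 -u0 norm_le_enorm.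
Qed.

Lemma enorm_gt0 u : (0 < enorm u) = (u != 0).
Proof. by rewrite lt_def enorm_eq0 enorm_ge0 andbT. Qed.

Lemma enormZ a u : enorm (a *: u) = `|a| * enorm u.
Proof.
by rewrite /enorm dotZl dotZr mulrA -expr2 sqrtrM ?sqr_ge0 // sqrtr_sqr.
Qed.

Lemma enormN u : enorm (- u) = enorm u.
Proof. by rewrite -scaleN1r enormZ normrN1 mul1r. Qed.

Lemma enormC u v : enorm (u - v) = enorm (v - u).
Proof. by rewrite -enormN opprB. Qed.

Lemma dot_le_enorm u v : dot u v <= enorm u * enorm v.
Proof.
have [->|u0] := eqVneq u 0; first by rewrite dot0l enorm0 mul0r.
have [->|v0] := eqVneq v 0; first by rewrite dotC dot0l enorm0 mulr0.
have : 0 <= dot (enorm v *: u - enorm u *: v) (enorm v *: u - enorm u *: v).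
  exact: dot_ge0.
have -> : dot (enorm v *: u - enorm u *: v) (enorm v *: u - enorm u *: v) =
    2 * (enorm u * enorm v) * (enorm u * enorm v - dot u v).
  by rewrite dotBl !dotBr !dotZl !dotZr (dotC v u) -!enorm_sqr; ring.
by rewrite pmulr_rge0 ?subr_ge0 // !mulr_gt0 ?enorm_gt0.
Qed.

Lemma normr_dot_le u v : `|dot u v| <= enorm u * enorm v.
Proof.
rewrite ler_norml dot_le_enorm andbT lerNl -dotNl -(enormN u).
exact: dot_le_enorm.
Qed.

Lemma ler_enormD u v : enorm (u + v) <= enorm u + enorm v.
Proof.
rewrite -(@ler_pXn2r _ 2) ?nnegrE ?addr_ge0 ?enorm_ge0 //.
rewrite enorm_sqr dotDl !dotDr (dotC v u) -!enorm_sqr.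
have := dot_le_enorm u v; lra.
Qed.

Lemma ler_enormB u v w : enorm (u - w) <= enorm (u - v) + enorm (v - w).
Proof. by rewrite (le_trans _ (ler_enormD _ _)) // addrA subrK. Qed.

Lemma nbhs_enormP x (A : set 'rV[R]_m) :
  nbhs x A <-> exists2 d, 0 < d & forall y, enorm (y - x) < d -> A y.
Proof.
split=> [/nbhs_ballP[d d0 dA]|[d d0 dA]].
  exists d => // y yx; apply: dA; rewrite -ball_normE /= distrC.
  exact: le_lt_trans (norm_le_enorm _) yx.
apply/nbhs_ballP; exists (d / m.+1%:R) => /=; first by rewrite divr_gt0.
move=> y; rewrite -ball_normE /= distrC => yx; apply: dA.
by rewrite (le_lt_trans (enorm_le_norm _)) // mulrC -ltr_pdivlMr.
Qed.

Lemma near_enorm x d : 0 < d -> \forall y \near x, enorm (y - x) < d.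
Proof. by move=> d0; apply/nbhs_enormP; exists d. Qed.

Lemma cvg_enormP {T : Type} {F : set_system T} {FF : Filter F}
    (h : T -> 'rV[R]_m) x :
  h @ F --> x <-> forall e, 0 < e -> \forall t \near F, enorm (h t - x) < e.
Proof.
split=> [hx e e0|hx A /nbhs_enormP[d d0 dA]].
  by have /hx := near_enorm x e0.
by apply: filterS (hx d d0) => t /dA.
Qed.

Lemma ler_dist_enorm x y z :
  `|enorm (z - x) - enorm (y - x)| <= enorm (y - z).
Proof.
rewrite ler_norml; apply/andP; split; first by have := ler_enormB y z x; lra.
by have := ler_enormB z y x; rewrite (enormC z y); lra.
Qed.

Lemma enorm_sub_continuous x : continuous (fun y => enorm (y - x)).
Proof.
move=> z; apply/(@cvgrPdist_lt _ _ _ (nbhs z)) => e e0.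
near=> y; have yz : enorm (y - z) < e by near: y; exact: near_enorm.
exact: le_lt_trans (ler_dist_enorm _ _ _) yz.
Unshelve. all: by end_near. Qed.

Lemma dot_continuousr u : continuous (dot u).
Proof.
move=> x; apply/(@cvgrPdist_lt _ _ _ (nbhs x)) => e e0.
have u1 : 0 < enorm u + 1 by rewrite ltr_wpDl ?enorm_ge0.
near=> y.
have : enorm (y - x) < e / (enorm u + 1).
  by near: y; apply: near_enorm; rewrite divr_gt0.
rewrite ltr_pdivlMr // -dotBr => yx.
apply: le_lt_trans (normr_dot_le _ _) _.
rewrite enormC; apply: le_lt_trans yx.
by rewrite mulrC ler_wpM2l ?enorm_ge0 // lerDl.
Unshelve. all: by end_near. Qed.

Lemma compact_enorm_closed x d (A : set 'rV[R]_m) : closed A ->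
  (forall y, A y -> enorm (y - x) <= d) -> compact A.
Proof.
move=> cA Ad; apply: bounded_closed_compact => //.
exists (d + `|x|); split; first exact: num_real.
move=> M dM y /Ad yd; apply: le_trans (ltW dM).
rewrite -[y in leLHS](subrK x); apply: le_trans (ler_normD _ _) _.
by rewrite lerD2r (le_trans (norm_le_enorm _)).
Qed.

Lemma compact_eball x d : compact [set y | enorm (y - x) <= d].
Proof.
apply: (@compact_enorm_closed x d) => //.
apply: (@closed_comp _ _ (fun y => enorm (y - x)) [set a | a <= d]).
  by move=> y _; exact: enorm_sub_continuous.
exact: closed_le.
Qed.

Lemma compact_esphere x d : compact [set y | enorm (y - x) = d].
Proof.
apply: (@compact_enorm_closed x d) => [|y /= ->//].
apply: (@closed_comp _ _ (fun y => enorm (y - x)) [set a | a = d]).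
  by move=> y _; exact: enorm_sub_continuous.
exact: closed_eq.
Qed.

End EuclideanSpace.

Section Semicontinuity.
Context {R : realType} {T : topologicalType}.
Implicit Types (g : T -> \bar R) (K : set T).
Local Open Scope ereal_scope.

Lemma ereal_between (x y : \bar R) : x < y ->
  exists2 a : R, x < a%:E & a%:E < y.
Proof.
case: x y => [r||] [s||] //=; rewrite ?lte_fin => rs.
- by exists ((r + s) / 2)%R; rewrite lte_fin midf_lt.
- by exists (r + 1)%R; rewrite ?ltry // lte_fin ltrDl.
- by exists (s - 1)%R; rewrite ?ltNyr // lte_fin ltrBlDr ltrDl.
- by exists 0%R; rewrite ?ltry ?ltNyr.
Qed.

Lemma lsc_compact_min g K : K !=set0 -> compact K -> lower_semicontinuous g ->
  exists2 p, K p & forall x, K x -> g p <= g x.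
Proof.
move=> [k Kk] cK lg; set i := ereal_inf (g @` K).
have iK x : K x -> i <= g x by move=> Kx; apply: ereal_inf_lbound; exists x.
have [iy|] := eqVneq i +oo.
  by exists k => // x /iK; rewrite iy leye_eq => /eqP ->; rewrite leey.
rewrite -ltey => iy.
pose B (a : \bar R) := [set x | K x /\ g x < a].
have FP : ProperFilter (filter_from [set a | i < a] B).
  apply: filter_from_proper; last first.
    move=> a /= ia; have [_ [x Kx <-] gxa] := ereal_inf_lt ia.
    by exists x.
  apply: filter_from_filter; first by exists +oo.
  move=> a b /= ia ib; exists (Order.min a b); first by rewrite lt_min ia.
  by move=> x [Kx]; rewrite lt_min => /andP[]; split.
have [|p [Kp cp]] := cK _ FP.
  by exists +oo => // x [].
exists p => // x Kx; apply: le_trans (iK _ Kx).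
rewrite leNgt; apply/negP => igp.
have [a ia agp] : exists2 a : R, i < a%:E & a%:E < g p.
  exact: ereal_between.
have FB : filter_from [set a | i < a] B (B a%:E) by exists a%:E.
have [U nU Ug] := lg _ _ agp; have [y [[_ yg] /Ug]] := cp _ _ FB nU.
by move=> /(lt_trans yg); rewrite ltxx.
Qed.

Lemma lscD_continuous g (h : T -> R) : lower_semicontinuous g ->
  (forall x, -oo < g x) -> continuous h ->
  lower_semicontinuous (fun x => g x + (h x)%:E).
Proof.
move=> lg gNy hc x a.
rewrite -lteBlDr // -EFinB => agx.
have [b ab bgx] : exists2 b : R, (a - h x)%R%:E < b%:E & b%:E < g x.
  exact: ereal_between.
have [V nV Vg] := lg _ _ bgx.
have nW : nbhs x (h @^-1` [set t | (a - b < t)%R]).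
  apply: hc; apply: open_nbhs_nbhs; split; first exact: open_gt.
  by move: ab; rewrite lte_fin /=; lra.
exists (V `&` h @^-1` [set t | (a - b < t)%R]); first exact: filterI.
move=> y [/Vg bgy /= hy]; rewrite -lteBlDr // -EFinB (lt_trans _ bgy)//.
rewrite lte_fin; lra.
Qed.

End Semicontinuity.

(** * Gradients and Euclidean first-order expansions *)

Section Differential.
Context {R : realType} {V W : normedModType R}.
Implicit Types (f : V -> W) (x : V).

Lemma differential_unique f (df : {linear V -> W}) x : continuous df ->
  (forall e, 0 < e ->
     \forall y \near x, `|f y - f x - df (y - x)| <= e * `|y - x|) ->
  differentiable f x /\ 'd f x = df :> (V -> W).
Proof.
move=> dfc fdf.
have dxf : f \o shift x = cst (f x) + df +o_ 0 id.
  apply/eqaddoP => e e0; have := fdf e e0.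
  rewrite (near_shift 0 x) subr0; apply: filterS => h /=.
  by rewrite addrK !fctE /= opprD addrA.
have dE := diff_unique dfc dxf.
by split=> //; apply/diff_locallyP; rewrite dE.
Qed.

Lemma differentiable_near f x : differentiable f x -> forall e, 0 < e ->
  \forall y \near x, `|f y - f x - 'd f x (y - x)| <= e * `|y - x|.
Proof.
move=> /diff_locallyP[_ /eqaddoP dxf] e e0; have : \forall h \near (0 : V),
    `|f (h + x) - (f x + 'd f x h)| <= e * `|h| by exact: dxf.
rewrite (near_shift x 0) sub0r; apply: filterS => h /=.
by rewrite subrK opprD addrA.
Qed.

End Differential.

Section Gradients.
Context {R : realType} {m : nat}.
Implicit Types (u v w x y z : 'rV[R]_m) (g : 'rV[R]_m -> R).

Definition has_grad g x v : Prop := forall e, 0 < e ->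
  \forall y \near x, `|g y - g x - dot v (y - x)| <= e * enorm (y - x).

Lemma has_gradP g x v : has_grad g x v -> forall e, 0 < e ->
  exists2 d, 0 < d & forall y, enorm (y - x) < d ->
    `|g y - g x - dot v (y - x)| <= e * enorm (y - x).
Proof. by move=> gv e /gv /nbhs_enormP. Qed.

Lemma has_grad_diff g x v : has_grad g x v ->
  differentiable g x /\ forall w, 'd g x w = dot v w.
Proof.
move=> gv.
have lin : linear (dot v : 'rV[R]_m -> R^o).
  by move=> a u w; rewrite dotDr dotZr.
pose L := GRing.isLinear.Build _ _ _ _ _ lin.
pose df : {linear 'rV[R]_m -> R^o} := HB.pack (dot v : 'rV[R]_m -> R^o) L.
have dfE w : df w = dot v w by [].
have dfc : continuous df by exact: dot_continuousr.
have gdf e : 0 < e ->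
    \forall y \near x, `|g y - g x - df (y - x)| <= e * `|y - x|.
  move=> e0; have e1 : 0 < e / m.+1%:R by rewrite divr_gt0.
  apply: filterS (gv _ e1) => y /le_trans; apply.
  by rewrite mulrAC ler_pdivrMr // -mulrA ler_pM2l // mulrC enorm_le_norm.
have [? dE] := @differential_unique R _ R^o g df x dfc gdf.
by split=> // w; rewrite dE.
Qed.

Lemma diff_has_grad g x : differentiable g x ->
  has_grad g x (\row_i 'd g x (delta_mx 0 i)).
Proof.
move=> gx e e0.
apply: filterS (@differentiable_near R _ R^o g x gx _ e0) => y.
have -> : 'd g x (y - x) = dot (\row_i 'd g x (delta_mx 0 i)) (y - x).
  rewrite {1}[y - x]row_sum_delta linear_sum dotE /=; apply: eq_bigr => i _.
  by rewrite linearZ mxE mulrC.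
by move=> /le_trans; apply; rewrite ler_pM2l // norm_le_enorm.
Qed.

Lemma has_grad_row g x v : has_grad g x v ->
  \row_i 'd g x (delta_mx 0 i) = v.
Proof.
move=> /has_grad_diff[_ dE]; apply/rowP => i; rewrite mxE dE dotE.
rewrite (bigD1 i) //= big1 ?addr0 => [|j ji].
  by rewrite mxE !eqxx mulr1.
by rewrite mxE (negPf ji) andbF mulr0.
Qed.

Lemma near_has_grad g h x v : (\forall y \near x, g y = h y) ->
  has_grad g x v -> has_grad h x v.
Proof.
move=> gh gv e e0; have ghx := nbhs_singleton gh.
by apply: filterS2 gh (gv _ e0) => y <-; rewrite ghx.
Qed.

Lemma has_grad_continuous g x v : has_grad g x v -> {for x, continuous g}.
Proof. by move=> /has_grad_diff[/differentiable_continuous]. Qed.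

Lemma ediffE (g : 'rV[R]_m -> \bar R) h x v :
  (\forall y \near x, g y = (h y)%:E) -> has_grad h x v ->
  ediff g x /\ grad g x = v.
Proof.
move=> gh hv.
have fgv : has_grad (fine \o g) x v.
  by apply: near_has_grad hv; apply: filterS gh => y /= ->.
split; last exact: has_grad_row.
split; first by apply: filterS gh => y ->.
by have [] := has_grad_diff fgv.
Qed.

Lemma has_grad_min g x v : has_grad g x v -> (forall y, g x <= g y) -> v = 0.
Proof.
move=> gv gmin; apply/eqP; apply/negPn/negP => v0.
have v1 : 0 < enorm v by rewrite enorm_gt0.
have e0 : 0 < enorm v / 2 by rewrite divr_gt0.
have [d d0 gd] := has_gradP gv e0.
pose t := d / 2 / enorm v.
have t0 : 0 < t by rewrite !divr_gt0.
have := gd (x - t *: v); rewrite addrAC subrr add0r enormN enormZ gtr0_norm //.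
have -> : t * enorm v = d / 2 by rewrite /t divfK ?gt_eqF.
rewrite gtr_pMr // invf_lt1 // ltr1n => /(_ isT).
rewrite ler_norml dotNr dotZr -enorm_sqr expr2 (mulrA t).
have -> : t * enorm v = d / 2 by rewrite /t divfK ?gt_eqF.
have := gmin (x - t *: v); nra.
Qed.

End Gradients.

(** * Bregman distances of strictly convex differentiable functions *)

Section Divergence.
Context {R : realType} {m : nat}.
Context (phi : 'rV[R]_m -> R) (P : 'rV[R]_m -> 'rV[R]_m).
Implicit Types (u v w x y z p : 'rV[R]_m).

(** The Bregman distance of [phi] as a real number; [P] stands for the
    gradient, so that no differentiability is needed to write it down. *)
Definition divergence x y : R := phi x - phi y - dot (P y) (x - y).

Local Notation D := divergence.

Definition strictly_convex_with_grad : Prop :=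
  (forall x, has_grad phi x (P x)) /\ (forall x y, x != y -> 0 < D x y).

Context (phiP : strictly_convex_with_grad).

Lemma divergence_xx x : D x x = 0.
Proof. by rewrite /D !subrr dotC dot0l subrr. Qed.

Lemma divergence_ge0 x y : 0 <= D x y.
Proof.
have [->|/(proj2 phiP)/ltW//] := eqVneq x y.
by rewrite divergence_xx.
Qed.

Lemma divergence_sym x y : D x y + D y x = dot (P x - P y) (x - y).
Proof. by rewrite /D dotBl -(opprB x y) dotNr; ring. Qed.

Lemma divergence3 y p x :
  D y x = D y p + D p x + dot (P p - P x) (y - p).
Proof. by rewrite /D dotBl !dotBr; ring. Qed.

Lemma divergence_le_dot x y : D x y <= dot (P x - P y) (x - y).
Proof. by rewrite -divergence_sym lerDl divergence_ge0. Qed.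

Lemma divergence_le x y : D x y <= enorm (P x - P y) * enorm (x - y).
Proof. exact: le_trans (divergence_le_dot _ _) (dot_le_enorm _ _). Qed.

Lemma divergence_has_grad x y : has_grad (D ^~ y) x (P x - P y).
Proof.
move=> e e0; apply: filterS ((proj1 phiP) x _ e0) => z.
congr (`|_| <= _); rewrite /D dotBl !dotBr; ring.
Qed.

(** Subgradients at [y] tested against a small step in the direction
    [P y - P x] cannot exceed the slope that differentiability imposes near
    [x]; no second-order information is involved. *)
Lemma grad_continuous : continuous P.
Proof.
move=> x; apply/(@cvg_enormP _ _ _ (nbhs x)) => e e0.
have e4 : 0 < e / 4 by rewrite divr_gt0.
have [d d0 phid] := has_gradP ((proj1 phiP) x) e4.
(* The step [u] has length [d / 2], so that [y + u] stays in the ball of radius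
   [d] on which the first-order expansion at [x] is valid. *)
have d2 : 0 < d / 2 by rewrite divr_gt0.
apply: filterS (near_enorm x d2) => y yx.
have [->|wN0] := eqVneq (P y) (P x); first by rewrite subrr enorm0.
have w0 : 0 < enorm (P y - P x) by rewrite enorm_gt0 subr_eq0.
pose u := (d / 2 / enorm (P y - P x)) *: (P y - P x).
have un : enorm u = d / 2.
  by rewrite enormZ gtr0_norm ?divr_gt0 // divfK ?gt_eqF.
have uw : dot (P y) u - dot (P x) u = d / 2 * enorm (P y - P x).
  by rewrite -dotBl dotZr -enorm_sqr expr2 mulrA divfK ?gt_eqF.
have yux : enorm (y + u - x) <= enorm (y - x) + d / 2.
  by rewrite addrAC -un ler_enormD.
have /phid : enorm (y + u - x) < d by lra.
have /phid : enorm (y - x) < d by lra.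
rewrite !ler_norml => /andP[yl _] /andP[_ yur].
have := divergence_ge0 (y + u) y.
rewrite /D addrKl => yu.
have yxu : dot (P x) (y + u - x) = dot (P x) (y - x) + dot (P x) u.
  by rewrite addrAC dotDr.
rewrite yxu in yur.
have : d / 2 * enorm (P y - P x) <= e / 4 * (3 * (d / 2)) by nra.
by have := mulr_gt0 d0 e0; nra.
Qed.

Lemma divergence_segment t u x : 0 <= t <= 1 ->
  D (x + t *: (u - x)) x <= t * D u x.
Proof.
move=> /andP[t0 t1]; set h := u - x; set w := x + t *: h.
have := divergence_ge0 u w; have := divergence_ge0 x w.
have hu : u - w = (1 - t) *: h.
  by rewrite /w /h scalerBl scale1r opprD addrA.
have hx : x - w = (- t) *: h by rewrite /w opprD addrA subrr add0r scaleNr.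
have hw : w - x = t *: h by rewrite /w addrKl.
rewrite /D hu hx hw !dotZr -/h => xw uw.
have t1' : 0 <= 1 - t by rewrite subr_ge0.
have := mulr_ge0 t0 uw; have := mulr_ge0 t1' xw; lra.
Qed.

(** Strict convexity gives a positive minimum on the sphere of radius [eps];
    convexity along rays turns it into linear growth outside the ball. *)
Lemma divergence_growth x eps : 0 < eps ->
  exists2 c, 0 < c & forall u, eps <= enorm (u - x) ->
    c * enorm (u - x) <= D u x.
Proof.
move=> e0.
have project u : eps <= enorm (u - x) ->
    enorm (x + (eps / enorm (u - x)) *: (u - x) - x) = eps.
  move=> eu; have u0 := lt_le_trans e0 eu.
  by rewrite addrKl enormZ gtr0_norm ?divr_gt0 // divfK ?gt_eqF.
have [[u0 eu0]|none] := pselect (exists u0, eps <= enorm (u0 - x)); last first.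
  by exists 1 => // u eu; case: none; exists u.
have [] := @EVT_min_rV _ _ (D ^~ x) [set y | enorm (y - x) = eps].
- by exists (x + (eps / enorm (u0 - x)) *: (u0 - x)); exact: project.
- exact: compact_esphere.
- apply: continuous_subspaceT => y.
  exact: has_grad_continuous (divergence_has_grad y x).
move=> s; rewrite inE /= => sx smin.
have Ds : 0 < D s x.
  by apply: (proj2 phiP); rewrite -subr_eq0 -enorm_eq0 sx gt_eqF.
exists (D s x / eps); first exact: divr_gt0.
move=> u eu; have u1 := lt_le_trans e0 eu.
have t01 : 0 <= eps / enorm (u - x) <= 1.
  apply/andP; split; first exact: divr_ge0 (ltW e0) (ltW u1).
  by rewrite ler_pdivrMr // mul1r.
have := smin (x + (eps / enorm (u - x)) *: (u - x)).
rewrite inE => /(_ (project u eu)) /le_trans/(_ (divergence_segment _ _ t01)).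
set r := enorm (u - x) => Dsu; have -> : D s x / eps * r = D s x * r / eps.
  by rewrite mulrAC.
rewrite ler_pdivrMr // -ler_pdivlMr // (le_trans Dsu) // mulrAC.
by rewrite (mulrC eps).
Qed.

(** This is the bound that differentiability of [phi] at [x] imposes on the
    conjugate of [phi] at [P x], read through [P]: evaluating the gradient
    inequality at [u] in a point at a fixed small distance from [x] suffices. *)
Lemma divergence_dual_growth x eps : 0 < eps ->
  exists2 c, 0 < c & forall u, eps <= enorm (P u - P x) ->
    c * enorm (P u - P x) <= D x u.
Proof.
move=> e0; have e2 : 0 < eps / 2 by rewrite divr_gt0.
have [d d0 phid] := has_gradP ((proj1 phiP) x) e2.
exists (d / 4); first by rewrite divr_gt0.
move=> u eu; have w0 := lt_le_trans e0 eu.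
pose h := (d / 2 / enorm (P u - P x)) *: (P u - P x).
have hn : enorm h = d / 2.
  by rewrite enormZ gtr0_norm ?divr_gt0 // divfK ?gt_eqF.
have hw : dot (P u) h - dot (P x) h = d / 2 * enorm (P u - P x).
  by rewrite -dotBl dotZr -enorm_sqr expr2 mulrA divfK ?gt_eqF.
have := phid (x + h); rewrite addrKl hn.
rewrite gtr_pMr // invf_lt1 // ltr1n => /(_ isT).
rewrite ler_norml => /andP[_ xh].
have := divergence_ge0 (x + h) u; rewrite /D => uh.
have uhE : dot (P u) (x + h - u) = dot (P u) (x - u) + dot (P u) h.
  by rewrite -dotDr addrAC.
rewrite uhE in uh.
have := mulr_ge0 (ltW d0) (enorm_ge0 (P u - P x)); nra.
Qed.

Lemma grad_inverse_continuous x eps : 0 < eps ->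
  exists2 c, 0 < c & forall u, enorm (P u - P x) < c -> enorm (u - x) < eps.
Proof.
move=> e0; have [c c0 growth] := divergence_growth x e0.
exists c => // u; apply: contraTT; rewrite -!leNgt => eu.
have u0 := lt_le_trans e0 eu.
by rewrite -(ler_pM2r u0) (le_trans (growth _ eu)) // divergence_le.
Qed.

(** By the three-point identity, the continuity of [D y] follows from that of
    [P] and from the upper bound [divergence_le]. *)
Lemma divergence_continuousr y : continuous (D y).
Proof.
move=> p; apply/(@cvgrPdist_lt _ R^o _ (nbhs p)) => e e0.
have b0 : 0 < 1 + enorm (y - p) by rewrite ltr_pwDl ?enorm_ge0.
near=> x.
have px : enorm (x - p) < 1 by near: x; exact: near_enorm.
have Ppx : enorm (P x - P p) < e / (1 + enorm (y - p)).
  near: x; have /cvg_enormP := @grad_continuous p; apply.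
  exact: divr_gt0.
have key : `|D y p - D y x| <= enorm (P x - P p) * (1 + enorm (y - p)).
  have := normr_dot_le (P p - P x) (y - p); rewrite (enormC (P p)).
  have := divergence_le p x; rewrite (enormC (P p)) (enormC p).
  have := divergence_ge0 p x.
  have := ler_wpM2l (enorm_ge0 (P x - P p)) (ltW px).
  rewrite (divergence3 y p x) !ler_norml mulrDr mulr1 => a b c /andP[d f].
  by apply/andP; split; lra.
by apply: le_lt_trans key _; rewrite -ltr_pdivlMr.
Unshelve. all: by end_near. Qed.

End Divergence.

(** * Finite Legendre functions and their conjugates *)

Section FiniteLegendre.
Context {R : realType} {m : nat}.
Context (phi : 'rV[R]_m -> \bar R).
Context (phi_legendre : legendre phi) (phi_dom : edom phi = setT).
Implicit Types x y : 'rV[R]_m.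

Lemma legendre_fin x : phi x = ((fine \o phi) x)%:E.
Proof.
have [[[_ phiNy] _ _] _ _] := phi_legendre.
rewrite /= fineK // fin_numElt phiNy /=.
by have : edom phi x by rewrite phi_dom.
Qed.

Lemma legendre_has_grad x : has_grad (fine \o phi) x (grad phi x).
Proof.
have [_ [_ phid _] _] := phi_legendre.
by apply: diff_has_grad; apply: (proj2 (phid x _)); rewrite phi_dom interiorT.
Qed.

Lemma legendre_divergence_ge0 x y :
  0 <= divergence (fine \o phi) (grad phi) x y.
Proof.
have [[_ _ convex] _ _] := phi_legendre.
rewrite subr_ge0; set h := x - y; apply/ler_addgt0Pr => e e0.
have h1 : 0 < 1 + enorm h by rewrite ltr_pwDl ?enorm_ge0.
have [d d0 phid] := has_gradP (legendre_has_grad y) (divr_gt0 e0 h1).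
(* This [t] satisfies both [t < 1] and [t * enorm h < d]. *)
pose t := d / (d + (1 + enorm h)).
have dh : 0 < d + (1 + enorm h) by rewrite addr_gt0.
have t0 : 0 < t by rewrite divr_gt0.
have t1 : t < 1 by rewrite ltr_pdivrMr // mul1r ltrDl.
have th : t * enorm h < d.
  rewrite mulrAC ltr_pdivrMr // ltr_pM2l //; lra.
have := phid (y + t *: h); rewrite addrKl enormZ gtr0_norm // => /(_ th).
rewrite dotZr ler_norml => /andP[lo _].
have := convex x y t; rewrite t0 t1 => /(_ isT).
have -> : t *: x + (1 - t) *: y = y + t *: h.
  by rewrite /h scalerBl scale1r scalerBr addrCA.
rewrite !legendre_fin -!EFinM -EFinD lee_fin => up.
have key : e / (1 + enorm h) * (t * enorm h) <= t * e.
  rewrite mulrCA ler_pM2l // mulrAC ler_pdivrMr // ler_pM2l //; lra.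
rewrite -(ler_pM2l t0); move: lo up key; rewrite /=; lra.
Qed.

Lemma legendre_subdiff x : limiting_subdiff phi x (grad phi x).
Proof.
split; first by rewrite legendre_fin.
exists (fun=> x), (fun=> grad phi x).
split=> //; [exact: cvg_cst|exact: cvg_cst| |exact: cvg_cst].
move=> _; split; first by rewrite legendre_fin.
move=> e e0; near=> y; rewrite !legendre_fin -EFinD lee_fin.
have := legendre_divergence_ge0 y x; rewrite /divergence.
have := mulr_ge0 (ltW e0) (enorm_ge0 (y - x)); lra.
Unshelve. all: by end_near. Qed.

(** Every point has a subgradient, so essential strict convexity is strict
    convexity on the whole space; the midpoint then makes the gradient
    inequality strict. *)
Lemma legendre_strictly_convex :
  strictly_convex_with_grad (fine \o phi) (grad phi).
Proof.
split=> [|x y xy]; first exact: legendre_has_grad.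
have [_ _ strict] := phi_legendre.
have half : 0 < (2^-1 : R) < 1 by apply/andP; split; lra.
have : strictly_convex_on setT phi.
  apply: strict => [? ? ? _ _|z _]; first by rewrite inE.
  by exists (grad phi z); exact: legendre_subdiff.
move=> /(_ x y 2^-1 I I xy half).
have := legendre_divergence_ge0 (2^-1 *: x + (1 - 2^-1) *: y) y.
rewrite /divergence.
have -> : 2^-1 *: x + (1 - 2^-1) *: y - y = 2^-1 *: (x - y).
  by rewrite scalerBl scale1r scalerBr [LHS]addrAC addrA subrK.
rewrite dotZr !legendre_fin -!EFinM -EFinD lte_fin /=; lra.
Qed.

End FiniteLegendre.

Section Conjugate.
Context {R : realType} {m : nat}.
Context (phi : 'rV[R]_m -> \bar R) (phir : 'rV[R]_m -> R).
Context (P : 'rV[R]_m -> 'rV[R]_m).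
Context (phiE : forall x, phi x = (phir x)%:E).
Context (phiP : strictly_convex_with_grad phir P).
Implicit Types (u v w x y z p : 'rV[R]_m).

Local Notation D := (divergence phir P).

Lemma conj_ge v x : ((dot v x - phir x)%:E <= convex_conj phi v)%E.
Proof. by apply: ereal_sup_ubound; exists x => //; rewrite phiE. Qed.

Lemma conj_le v b : (forall x, dot v x - phir x <= b) ->
  (convex_conj phi v <= b%:E)%E.
Proof.
by move=> vb; apply: ge_ereal_sup => _ [x _ <-]; rewrite phiE lee_fin.
Qed.

Lemma conj_grad x : convex_conj phi (P x) = (dot (P x) x - phir x)%:E.
Proof.
apply/le_anti; rewrite conj_ge andbT; apply: conj_le => u.
by have := divergence_ge0 phiP u x; rewrite /divergence dotBr; lra.
Qed.

(** Outside the unit ball around [x] the gap in the gradient inequality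
    dominates every tilt of slope less than [c], so the conjugate stays finite
    on the ball of radius [c] around [P x]. *)
Lemma grad_interior_conj x : (edom (convex_conj phi))° (P x).
Proof.
have [c c0 growth] := divergence_growth phiP x ltr01.
apply/nbhs_enormP; exists c => // w wx.
apply: (@le_lt_trans _ _ (dot w x - phir x + c)%:E); last exact: ltry.
apply: conj_le => u.
have := dot_le_enorm (w - P x) (u - x); rewrite dotBl.
have : dot w (u - x) = dot w u - dot w x by rewrite dotBr.
have := divergence_ge0 phiP u x.
have := ler_wpM2r (enorm_ge0 (u - x)) (ltW wx).
have [/growth|/ltW/(ler_wpM2l (ltW c0))] := leP 1 (enorm (u - x));
  rewrite /divergence; lra.
Qed.

(** If the conjugate is finite at the finitely many points
    [z +- (d / 2) e_i], then [phi - <z, .>] dominates a multiple of the norm,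
    hence has a minimiser, and [z] is the gradient of [phi] there. *)
Lemma interior_conj_grad z : (edom (convex_conj phi))° z ->
  exists x, P x = z.
Proof.
move=> /nbhs_enormP[d d0 dz].
pose e (i : 'I_m) : 'rV[R]_m := delta_mx 0 i.
have de v i : dot v (e i) = v 0 i.
  rewrite dotE (bigD1 i) //= big1 ?addr0 => [|j ji]; rewrite mxE.
    by rewrite !eqxx mulr1.
  by rewrite (negPf ji) andbF mulr0.
have e1 i : enorm (e i) = 1 by rewrite /enorm de mxE !eqxx sqrtr1.
pose cr w := fine (convex_conj phi w).
have crP w u : enorm (w - z) < d -> dot w u - phir u <= cr w.
  move=> /dz wfin; rewrite -lee_fin fineK ?conj_ge // fin_numElt.
  by rewrite [X in _ && X]wfin (lt_le_trans _ (conj_ge w 0)) // ltNyr.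
have near_z (s : R) i : `|s| = d / 2 -> enorm (z + s *: e i - z) < d.
  by move=> sd; rewrite addrKl enormZ e1 mulr1 sd; lra.
pose B := \sum_i (`|cr (z + (d / 2) *: e i)| + `|cr (z + (- (d / 2)) *: e i)|).
pose h u := phir u - dot z u.
have hB u i : d / 2 * `|u 0 i| <= h u + B.
  have d2 : `|d / 2| = d / 2 by rewrite gtr0_norm // divr_gt0.
  have d2N : `|- (d / 2)| = d / 2 by rewrite normrN.
  have := crP _ u (near_z _ i d2); have := crP _ u (near_z _ i d2N).
  rewrite !dotDl !dotZl ![dot (e i) u]dotC !de.
  have : `|cr (z + (d / 2) *: e i)| + `|cr (z + (- (d / 2)) *: e i)| <= B.
    rewrite /B (bigD1 i) //= lerDl; apply: sumr_ge0 => j _.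
    by rewrite addr_ge0.
  have := ler_norm (cr (z + (d / 2) *: e i)).
  have := ler_norm (cr (z + (- (d / 2)) *: e i)).
  have := normr_ge0 (cr (z + (d / 2) *: e i)).
  have := normr_ge0 (cr (z + (- (d / 2)) *: e i)).
  by rewrite /h; case: (ger0P (u 0 i)) => _; lra.
pose rho := m.+1%:R * `|(h 0 + B) / (d / 2)|.
have sublevel u : h u <= h 0 -> enorm (u - 0) <= rho.
  move=> hu; rewrite subr0 (le_trans (enorm_le_norm _)) // ler_wpM2l //.
  rewrite [leLHS]mx_normrE; apply/bigmax_leP; split => // -[j i] _ /=.
  rewrite (ord1 j) (le_trans _ (ler_norm _)) // ler_pdivlMr ?divr_gt0 // mulrC.
  by rewrite (le_trans (hB u i)) // lerD2r.
have hgrad x : has_grad h x (P x - z).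
  move=> a a0; apply: filterS ((proj1 phiP) x _ a0) => y.
  congr (`|_| <= _); rewrite /h !dotBl !dotBr; ring.
have [|||x] := @EVT_min_rV _ _ h [set u | enorm (u - 0) <= rho].
- by exists 0; exact: sublevel.
- exact: compact_eball.
- by apply: continuous_subspaceT => y; exact: has_grad_continuous (hgrad y).
rewrite inE /= => _ xmin; exists x; apply/eqP; rewrite -subr_eq0; apply/eqP.
apply: (has_grad_min (hgrad x)) => u.
have [hu|/ltW hu] := leP (h u) (h 0).
  by apply: xmin; rewrite inE; exact: sublevel.
by apply: le_trans hu; apply: xmin; rewrite inE; exact: sublevel.
Qed.

Lemma near_grad_range x : \forall w \near P x, exists u, P u = w.
Proof.
have : nbhs (P x) (edom (convex_conj phi))°.
  apply: open_nbhs_nbhs; split; first exact: open_interior.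
  exact: grad_interior_conj.
by apply: filterS => w; exact: interior_conj_grad.
Qed.

(** Near [P x] the increment of the conjugate differs from the linear term
    [<x, .>] by a Bregman distance, which [divergence_le] and the continuity
    of the inverse of [P] show to be negligible. *)
Lemma grad_conj x : grad (convex_conj phi) (P x) = x.
Proof.
have fin : \forall w \near P x,
    convex_conj phi w = ((fine \o convex_conj phi) w)%:E.
  by apply: filterS (near_grad_range x) => _ [u <-]; rewrite /= conj_grad.
apply: (proj2 (ediffE fin _)) => e e0.
have [c c0 Pc] := grad_inverse_continuous phiP x e0.
apply: filterS2 (near_grad_range x) (near_enorm (P x) c0) => _ [u <-] /Pc ux.
rewrite /= !conj_grad /=.
have -> : dot (P u) u - phir u - (dot (P x) x - phir x) - dot x (P u - P x) =
    D x u by rewrite /divergence !dotBr ![dot x _]dotC; ring.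
rewrite ger0_norm ?divergence_ge0 //.
apply: le_trans (divergence_le phiP _ _) _.
by rewrite enormC mulrC ler_wpM2r ?enorm_ge0 // enormC ltW.
Qed.

Lemma bregman_conj u x : bregman (convex_conj phi) (P u) (P x) = (D x u)%:E.
Proof.
rewrite /bregman asboolT; last exact: grad_interior_conj.
rewrite grad_conj !conj_grad -!EFinB; congr EFin.
by rewrite /divergence !dotBr ![dot x _]dotC; ring.
Qed.

Lemma bregman_conj_gtNy z x :
  (-oo < bregman (convex_conj phi) z (P x))%E.
Proof.
rewrite /bregman asboolT; last exact: grad_interior_conj.
rewrite conj_grad -addeA -!EFinN -EFinD.
apply: lt_le_trans (leeD2r _ (conj_ge z 0)).
by rewrite -EFinD ltNyr.
Qed.

Lemma bregmanE y x : bregman phi y x = (D y x)%:E.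
Proof.
have domT : edom phi = setT.
  by apply/seteqP; split => // u _; rewrite /edom /= phiE ltry.
rewrite /bregman asboolT ?domT ?interiorT // !phiE.
have /ediffE/(_ ((proj1 phiP) x))[_ ->] :
    \forall w \near x, phi w = (phir w)%:E.
  by near=> w; exact: phiE.
by rewrite -!EFinB.
Unshelve. all: by end_near. Qed.

Lemma comp_grad_conjE (f : 'rV[R]_m -> \bar R) x :
  comp_grad_conj f phi (P x) = f x.
Proof.
by rewrite /comp_grad_conj asboolT ?grad_conj //; exact: grad_interior_conj.
Qed.

Lemma comp_grad_conj_out (f : 'rV[R]_m -> \bar R) z :
  (forall x, P x <> z) -> comp_grad_conj f phi z = +oo%E.
Proof.
move=> zN; rewrite /comp_grad_conj asboolF // => /interior_conj_grad[x].
exact: zN.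
Qed.

End Conjugate.

(** * Right proximal map and envelope near a prox-regular point *)

Section Growth.
Context {R : realType} {m : nat}.
Context (phi : 'rV[R]_m -> R) (P : 'rV[R]_m -> 'rV[R]_m).
Context (phiP : strictly_convex_with_grad phi P).
Context (f : 'rV[R]_m -> \bar R) (xb vb : 'rV[R]_m).
Context (fxb : f xb \is a fin_num).
Implicit Types (x y p : 'rV[R]_m).

Local Notation D := (divergence phi P).

(** The bound [l0] depends only on the data at [xb]: [l <= l1 / 2] keeps half
    of the Bregman distance in the prox-boundedness estimate, [l r < 1] does
    the same in the prox-regularity estimate, and the last bound makes the
    linear error terms, collected in [C], at most half of what remains. *)
Lemma prox_growth (e r l1 c0 : R) (y0 : 'rV[R]_m) :
  0 < e -> 0 <= r -> 0 < l1 ->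
  (forall x, enorm (P x - P xb) < e ->
     (f xb + (dot vb (P x - P xb) - r * D xb x)%:E <= f x)%E) ->
  (forall x, ((c0 - l1^-1 * D y0 x)%:E <= f x)%E) ->
  exists2 l0, 0 < l0 & forall l, 0 < l -> l < l0 -> l * r < 1 /\
    forall d, 0 < d -> exists2 c, 0 < c & forall x, d <= enorm (P x - P xb) ->
      (f xb + (l^-1 * (D (xb + l *: vb) xb - D (xb + l *: vb) x
                       + c * enorm (P x - P xb)))%:E <= f x)%E.
Proof.
move=> e0 r0 l10 local global.
have [k k0 growth] := divergence_dual_growth phiP xb e0.
pose M := `|fine (f xb) - c0 + l1^-1 * D y0 xb|.
pose C := M / e + l1^-1 * enorm (y0 - xb) + enorm vb.
have C0 : 0 <= C.
  by rewrite !addr_ge0 ?mulr_ge0 ?enorm_ge0 ?normr_ge0 ?invr_ge0 ?(ltW e0)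
    ?(ltW l10).
have C1 : 0 < 4 * (C + 1) by lra.
have r1 : 0 < r + 1 by lra.
exists (Num.min (l1 / 2) (Num.min (r + 1)^-1 (k / (4 * (C + 1))))).
  by rewrite !lt_min invr_gt0 r1 !divr_gt0.
move=> l l0; rewrite !lt_min => /and3P[ll1 llr llk].
have {}ll1 : l * l1^-1 < 1 / 2 by rewrite ltr_pdivrMr //; lra.
have {}llr : l * r < 1.
  by have : l * (r + 1) < 1; [rewrite -ltr_pdivlMr ?div1r|lra].
have {}llk : l * C <= k / 4.
  by have : l * (4 * (C + 1)) < k; [rewrite -ltr_pdivlMr|lra].
split=> // d d0.
have [kd kd0 growthd] := divergence_dual_growth phiP xb d0.
have lr0 : 0 < 1 - l * r by lra.
exists (Num.min ((1 - l * r) * kd) (k / 4)).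
  by rewrite lt_min mulr_gt0 //= divr_gt0.
move=> x dx; set c := Num.min _ _; set a := enorm (P x - P xb).
have a0 : 0 <= a by exact: enorm_ge0.
have -> : D (xb + l *: vb) xb - D (xb + l *: vb) x =
    l * dot vb (P x - P xb) - D xb x.
  rewrite (divergence3 phi P (xb + l *: vb) xb x) addrKl dotZr.
  by rewrite -(opprB (P x)) dotNl dotC; ring.
have clr : c <= (1 - l * r) * kd by rewrite ge_min lexx.
have ck : c <= k / 4 by rewrite ge_min lexx orbT.
(* Prox-regularity covers the ball of radius [e] around [P xb]. *)
have [xe|ex] := ltP a e.
  apply: le_trans (local x xe); rewrite leeD2lE // lee_fin.
  rewrite -(ler_pM2l l0) mulVKf ?gt_eqF //.
  have := growthd x dx; rewrite -/a => kdD.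
  have := ler_wpM2r a0 clr; have := ler_wpM2l (ltW lr0) kdD; nra.
(* Outside that ball constants are also bounded by a multiple of [a]. *)
apply: le_trans (global x); rewrite -(fineK fxb) -EFinD lee_fin.
rewrite -(ler_pM2l l0) mulrDr mulVKf ?gt_eqF // mulrBr.
have kD := growth x ex; rewrite -/a in kD.
have vba : dot vb (P x - P xb) <= enorm vb * a by exact: dot_le_enorm.
have y0a : D y0 x <= D y0 xb + D xb x + enorm (y0 - xb) * a.
  rewrite (divergence3 phi P y0 xb x) lerD2l mulrC /a enormC.
  exact: dot_le_enorm.
have Me : fine (f xb) - c0 + l1^-1 * D y0 xb <= M / e * a.
  rewrite (le_trans (ler_norm _)) // mulrAC ler_pdivlMr // ler_wpM2l //.
have l1i : 0 <= l1^-1 by rewrite invr_ge0 ltW.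
have D0 : 0 <= D xb x by exact: divergence_ge0.
have h1 : l * l1^-1 * D xb x <= 1 / 2 * D xb x by rewrite ler_wpM2r // ltW.
have h2 : l * (l1^-1 * D y0 x) <=
    l * (l1^-1 * (D y0 xb + D xb x + enorm (y0 - xb) * a)).
  by rewrite ler_pM2l // ler_wpM2l.
have h3 := ler_wpM2l (ltW l0) Me; have h4 := ler_wpM2l (ltW l0) vba.
have h5 := ler_wpM2r a0 llk; have h6 := ler_wpM2r a0 ck.
move: h5; rewrite /C; lra.
Qed.

End Growth.

Section ProximalMap.
Context {R : realType} {m : nat}.
Context (phi : 'rV[R]_m -> R) (P : 'rV[R]_m -> 'rV[R]_m).
Context (phiP : strictly_convex_with_grad phi P).
Context (f : 'rV[R]_m -> \bar R).
Context (f_gtNy : forall x, (-oo < f x)%E) (f_lsc : lower_semicontinuous f).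
Implicit Types (x y p : 'rV[R]_m) (l : R).

Local Notation D := (divergence phi P).

(** [p] minimises [f x + D y x / l], written so that only one value of [f],
    possibly infinite, occurs on the right-hand side. *)
Definition prox_minimizer l y p : Prop := f p \is a fin_num /\
  forall x, (f p + (l^-1 * (D y p - D y x))%:E <= f x)%E.

Lemma prox_minimizer_fin l y p x : prox_minimizer l y p -> f x \is a fin_num ->
  fine (f p) + l^-1 * (D y p - D y x) <= fine (f x).
Proof.
by move=> [fp /(_ x)] pmin fx; rewrite -lee_fin EFinD !fineK.
Qed.

Lemma prox_minimizerP l y p : prox_minimizer l y p <->
  (f p + (l^-1 * D y p)%:E < +oo)%E /\
  forall x, (f p + (l^-1 * D y p)%:E <= f x + (l^-1 * D y x)%:E)%E.
Proof.
split=> [[fp pmin]|[fp pmin]].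
  split=> [|x]; first by rewrite -(fineK fp) -EFinD ltry.
  rewrite -leeBlDr // -addeA -EFinN -EFinD -mulrBr; exact: pmin.
have fpf : f p \is a fin_num.
  by move: fp (f_gtNy p); case: (f p).
split=> // x; rewrite mulrBr EFinB addeA leeBlDr //; exact: pmin.
Qed.

Lemma divergence_prox y p x :
  D y p - D y x = dot (P x - P p) (y - p) - D p x.
Proof. by rewrite (divergence3 phi P y p x) -(opprB (P x)) dotNl; ring. Qed.

Context (l : R) (l0 : 0 < l).

(** Fermat's rule for the smooth-plus-[F] objective: the remainder [D p x / l]
    is [o (|P x - P p|)] because [P] has a continuous inverse. *)
Lemma prox_regular_subdiff (F : 'rV[R]_m -> \bar R) y p :
  (forall x, F (P x) = f x) -> (\forall z \near P p, exists x, P x = z) ->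
  prox_minimizer l y p -> limiting_subdiff F (P p) (l^-1 *: (y - p)).
Proof.
move=> FP rangeP [fp pmin].
have sub : regular_subdiff F (P p) (l^-1 *: (y - p)).
  split=> [|e e0]; first by rewrite FP.
  have [c c0 Pc] := grad_inverse_continuous phiP p (mulr_gt0 l0 e0).
  apply: filterS2 rangeP (near_enorm (P p) c0) => _ [x <-] /Pc xp.
  rewrite !FP; apply: le_trans (pmin x); rewrite leeD2lE // lee_fin.
  rewrite divergence_prox -(ler_pM2l l0) mulVKf ?gt_eqF // dotZl mulrBr.
  rewrite mulVKf ?gt_eqF // (dotC (y - p)) lerD2l lerN2.
  apply: le_trans (divergence_le phiP _ _) _.
  by rewrite enormC mulrA mulrC ler_wpM2r ?enorm_ge0 // enormC ltW.
split; first by case: sub.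
exists (fun=> P p), (fun=> l^-1 *: (y - p)).
by split=> //; exact: cvg_cst.
Qed.

Context (xb yb vb : 'rV[R]_m) (ybE : yb = xb + l *: vb).
Context (fxb : f xb \is a fin_num).
Context (growth : forall d, 0 < d -> exists2 c, 0 < c &
  forall x, d <= enorm (P x - P xb) ->
    (f xb + (l^-1 * (D yb xb - D yb x + c * enorm (P x - P xb)))%:E <= f x)%E).

(** Replacing [yb] by [y] changes the objective by a term of slope
    [|y - yb| / l] in [P x], which is less than the available growth. *)
Lemma prox_growth_near d : 0 < d -> exists2 c, 0 < c &
  forall x y, d <= enorm (P x - P xb) -> enorm (y - yb) < c ->
    (f xb + (l^-1 * (D y xb - D y x))%:E < f x)%E.
Proof.
move=> d0; have [c c0 gr] := growth d0.
exists c => // x y dx yc; apply: lt_le_trans (gr x dx).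
rewrite lteD2lE // lte_fin ltr_pM2l ?invr_gt0 // !divergence_prox.
have a0 := lt_le_trans d0 dx.
have := dot_le_enorm (P x - P xb) (y - yb).
have : dot (P x - P xb) (y - xb) =
    dot (P x - P xb) (y - yb) + dot (P x - P xb) (yb - xb).
  by rewrite -dotDr addrA subrK.
have : enorm (P x - P xb) * enorm (y - yb) < enorm (P x - P xb) * c.
  by rewrite ltr_pM2l.
rewrite mulrC; lra.
Qed.

Lemma prox_minimizer_near d : 0 < d -> exists2 c, 0 < c &
  forall y p, enorm (y - yb) < c -> prox_minimizer l y p ->
    enorm (P p - P xb) < d.
Proof.
move=> /prox_growth_near[c c0 gr]; exists c => // y p yc pmin.
rewrite ltNge; apply/negP => /gr/(_ yc).
have := prox_minimizer_fin pmin fxb; case: pmin => fp _.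
rewrite -(fineK fp) -(fineK fxb) -EFinD lte_fin /= => a b.
by move: a b; rewrite !mulrBr; lra.
Qed.

(** The objective as a function of [P x] may fail to be lower semicontinuous at
    the boundary of the range of [P]. Minimising over a ball around [xb] is
    enough, since by [prox_growth_near] no point outside competes with [xb]. *)
Lemma prox_minimizer_exists : exists2 c, 0 < c &
  forall y, enorm (y - yb) < c -> exists p, prox_minimizer l y p.
Proof.
have [d d0 Pd] := grad_inverse_continuous phiP xb (ltr01 : 0 < 1 :> R).
have [c c0 gr] := prox_growth_near d0.
exists c => // y yc.
have [|||p pb pmin] :=
    @lsc_compact_min R _ (fun x => f x + (l^-1 * D y x)%:E)%E
      [set x | enorm (x - xb) <= 1].
- by exists xb; rewrite /= subrr enorm0 ler01.
- exact: compact_eball.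
- apply: lscD_continuous => // x.
  apply: (@cvgM R _ (nbhs x) _ (cst l^-1)); first exact: cvg_cst.
  exact: divergence_continuousr.
have pxb := pmin xb; rewrite /= subrr enorm0 ler01 in pxb.
exists p; apply/prox_minimizerP; split.
  by apply: le_lt_trans (pxb isT) _; rewrite -(fineK fxb) -EFinD ltry.
move=> x; have [/pmin//|x1] := leP (enorm (x - xb)) 1.
apply: le_trans (pxb isT) _; rewrite -leeBlDr // -addeA -EFinN -EFinD -mulrBr.
apply/ltW/gr => //; rewrite leNgt; apply/negP => /Pd.
by rewrite ltNge ltW.
Qed.

Context (F : 'rV[R]_m -> \bar R) (e r : R).
Context (FP : forall x, F (P x) = f x).
Context (rangeP : forall p, \forall z \near P p, exists x, P x = z).
Context (e0 : 0 < e) (lr1 : l * r < 1).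
Context (f_reg : forall x p w,
  enorm (P x - P xb) < e -> enorm (P p - P xb) < e ->
  (f p - f xb < e%:E)%E -> limiting_subdiff F (P p) w -> enorm (w - vb) < e ->
  (f p + (dot w (P x - P p) - r * D p x)%:E <= f x)%E).

(** Minimisers near [P xb] satisfy the localisation conditions of
    prox-regularity: besides [P p], also the value [f p], which exceeds [f xb]
    by at most [|P p - P xb| |y - xb| / l], and the subgradient
    [(y - p) / l] are close to those at [xb]. *)
Lemma prox_regular_near : exists2 c, 0 < c & forall y p,
  enorm (y - yb) < c -> prox_minimizer l y p -> enorm (P p - P xb) < e /\
  forall x, enorm (P x - P xb) < e ->
    (f p + (dot (l^-1 *: (y - p)) (P x - P p) - r * D p x)%:E <= f x)%E.
Proof.
have le2 : 0 < l * e / 2 by rewrite divr_gt0 // mulr_gt0.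
have [c2 c20 Pc2] := grad_inverse_continuous phiP xb le2.
pose N := 1 + l * enorm vb.
have N0 : 0 < N by rewrite ltr_pwDl // mulr_ge0 ?enorm_ge0 ?ltW.
pose d := Num.min e (Num.min c2 (l * e / N)).
have d0 : 0 < d by rewrite !lt_min e0 c20 divr_gt0 // mulr_gt0.
have [c c0 near] := prox_minimizer_near d0.
exists (Num.min c (Num.min (l * e / 2) 1)).
  by rewrite !lt_min c0 le2 ltr01.
move=> y p; rewrite !lt_min => /and3P[yc yle y1] pmin.
have := near y p yc pmin; rewrite !lt_min => /and3P[pe /Pc2 pxb pN].
split=> // x xe; apply: f_reg => //.
- case: (pmin) => fp _; rewrite -(fineK fp) -(fineK fxb) -EFinB lte_fin.
  rewrite -(ltr_pM2l l0).
  have := prox_minimizer_fin pmin fxb; rewrite -(ler_pM2l l0) mulrDr.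
  rewrite mulVKf ?gt_eqF //.
  have := divergence_prox y xb p; have := divergence_ge0 phiP xb p.
  have := dot_le_enorm (P p - P xb) (y - xb).
  have yN : enorm (y - xb) <= N.
    apply: le_trans (ler_enormB y yb xb) _; apply: lerD; first exact: ltW.
    by rewrite ybE addrKl enormZ gtr0_norm.
  have := ler_wpM2l (enorm_ge0 (P p - P xb)) yN.
  move: pN; rewrite ltr_pdivlMr //; lra.
- exact: prox_regular_subdiff.
- have -> : l^-1 *: (y - p) - vb = l^-1 *: ((y - yb) - (p - xb)).
    have -> : y - yb - (p - xb) = (y - p) - l *: vb.
      by rewrite ybE; apply/rowP => i; rewrite !mxE; ring.
    by rewrite [RHS]scalerBr scalerA mulVf ?gt_eqF // scale1r.
  rewrite enormZ gtr0_norm ?invr_gt0 // mulrC ltr_pdivrMr //.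
  have := ler_enormD (y - yb) (- (p - xb)); rewrite enormN; lra.
Qed.

(** Adding the prox-regularity inequalities at two minimisers makes the
    values of [f] cancel; what remains is strong monotonicity of the proximal
    map, measured by the divergence. *)
Lemma prox_monotone : exists2 c, 0 < c & forall y y' p p',
  enorm (y - yb) < c -> enorm (y' - yb) < c ->
  prox_minimizer l y p -> prox_minimizer l y' p' ->
  (1 - l * r) * dot (P p' - P p) (p' - p) <= dot (P p' - P p) (y' - y).
Proof.
have [c c0 reg] := prox_regular_near.
exists c => // y y' p p' yc yc' pmin pmin'.
have [pe preg] := reg y p yc pmin; have [pe' preg'] := reg y' p' yc' pmin'.
have := preg p' pe'; have := preg' p pe.
case: (pmin) => fp _; case: (pmin') => fp' _.
rewrite -(fineK fp) -(fineK fp') -!EFinD !lee_fin.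
have := divergence_sym phi P p' p.
rewrite -(opprB (P p')) dotNr !dotZl !(dotC _ (P p' - P p)).
set w := P p' - P p => Dsym a b.
have : l * (l^-1 * dot w (y - p) - l^-1 * dot w (y' - p')
            - r * dot w (p' - p)) <= l * 0.
  by rewrite ler_pM2l // -Dsym; lra.
rewrite mulr0 !mulrBr !mulrA mulfV ?gt_eqF // !mul1r !dotBr; lra.
Qed.

Lemma prox_map : exists pr c, [/\ 0 < c,
  forall y, enorm (y - yb) < c -> prox_minimizer l y (pr y),
  forall y p, enorm (y - yb) < c -> prox_minimizer l y p -> p = pr y &
  forall y y', enorm (y - yb) < c -> enorm (y' - yb) < c ->
    (1 - l * r) * dot (P (pr y') - P (pr y)) (pr y' - pr y) <=
    dot (P (pr y') - P (pr y)) (y' - y)].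
Proof.
have [c1 c10 ex] := prox_minimizer_exists.
have [c2 c20 mono] := prox_monotone.
have /choice[pr prP] y :
    exists p, enorm (y - yb) < c1 -> prox_minimizer l y p.
  have [/ex[p pmin]|] := ltP (enorm (y - yb)) c1; first by exists p.
  by rewrite leNgt => /negP yc; exists y.
exists pr, (Num.min c1 c2); split; first by rewrite lt_min c10.
- by move=> y; rewrite lt_min => /andP[/prP].
- move=> y p; rewrite lt_min => /andP[/prP pmin yc] pmin'.
  have := mono _ _ _ _ yc yc pmin pmin'.
  rewrite subrr (dotC _ 0) dot0l pmulr_rle0 ?subr_gt0 // => pp.
  apply/eqP/negPn/negP => /(proj2 phiP); rewrite ltNge => /negP; apply.
  exact: le_trans (divergence_le_dot phiP _ _) pp.
- move=> y y'; rewrite !lt_min => /andP[/prP pmin yc] /andP[/prP pmin' yc'].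
  exact: mono.
Qed.

End ProximalMap.

Section Envelope.
Context {R : realType} {m : nat}.
Context (phi : 'rV[R]_m -> R) (P : 'rV[R]_m -> 'rV[R]_m).
Context (phiP : strictly_convex_with_grad phi P).
Context (f : 'rV[R]_m -> \bar R) (l r c : R) (yb : 'rV[R]_m).
Context (pr : 'rV[R]_m -> 'rV[R]_m).
Context (l0 : 0 < l) (lr1 : l * r < 1).
Context (pr_min :
  forall y, enorm (y - yb) < c -> prox_minimizer phi P f l y (pr y)).
Context (pr_mono : forall y y', enorm (y - yb) < c -> enorm (y' - yb) < c ->
  (1 - l * r) * dot (P (pr y') - P (pr y)) (pr y' - pr y) <=
  dot (P (pr y') - P (pr y)) (y' - y)).
Implicit Types (x y p : 'rV[R]_m).

Local Notation D := (divergence phi P).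

Lemma near_in_ball y : enorm (y - yb) < c ->
  \forall y' \near y, enorm (y' - yb) < c.
Proof.
move=> yc; have yc0 : 0 < c - enorm (y - yb) by rewrite subr_gt0.
apply: filterS (near_enorm y yc0) => y' yy'.
by apply: le_lt_trans (ler_enormB _ y _) _; rewrite -ltrBrDr.
Qed.

(** [prox_monotone] bounds [(1 - l r) D (pr y) (pr y')] by
    [|P (pr y') - P (pr y)| |y' - y|], whereas the left-hand side grows at
    least linearly in [|P (pr y') - P (pr y)|]. *)
Lemma prox_continuous y eps : 0 < eps -> enorm (y - yb) < c ->
  \forall y' \near y, enorm (P (pr y') - P (pr y)) < eps.
Proof.
move=> eps0 yc; have [k k0 growth] := divergence_dual_growth phiP (pr y) eps0.
have lr0 : 0 < 1 - l * r by rewrite subr_gt0.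
apply: filterS2 (near_in_ball yc) (near_enorm y (mulr_gt0 lr0 k0)).
move=> y' yc' yy'.
rewrite ltNge; apply/negP => big.
have a0 := lt_le_trans eps0 big.
have := growth _ big; have := divergence_sym phi P (pr y') (pr y).
have := divergence_ge0 phiP (pr y') (pr y); move=> D0 Dsym kD.
have : (1 - l * r) * (k * enorm (P (pr y') - P (pr y))) <=
    enorm (P (pr y') - P (pr y)) * enorm (y' - y).
  apply: le_trans (dot_le_enorm _ _); apply: le_trans (pr_mono yc yc').
  by rewrite ler_pM2l // -Dsym; lra.
by rewrite mulrA mulrC ler_pM2l // leNgt yy'.
Qed.

(** The value of the proximal problem at [y], read off from its selected
    minimiser. *)
Definition envelope y : R := fine (f (pr y)) + l^-1 * D y (pr y).

(** Testing each of the two minimisers in the problem of the other one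
    squeezes the increment of the envelope between two linear terms, whose
    difference the continuity of the proximal map makes negligible. *)
Lemma envelope_has_grad y : enorm (y - yb) < c ->
  has_grad envelope y (l^-1 *: (P y - P (pr y))).
Proof.
move=> yc e e0; have le0 : 0 < l * e by rewrite mulr_gt0.
have Pnear : \forall y' \near y, enorm (P y' - P y) < l * e.
  by have /cvg_enormP := @grad_continuous _ _ _ _ phiP y; apply.
apply: filterS3 (near_in_ball yc) Pnear (prox_continuous le0 yc).
move=> y' yc' Py Ppr.
have [[fp _] [fp' _]] := (pr_min yc, pr_min yc').
have D0 := divergence_ge0 phiP y' y.
have Dle := le_trans (divergence_le phiP y' y)
  (ler_wpM2r (enorm_ge0 (y' - y)) (ltW Py)).
have Ple : `|dot (P (pr y) - P (pr y')) (y' - y)| <= l * e * enorm (y' - y).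
  apply: le_trans (normr_dot_le _ _) _.
  by rewrite ler_wpM2r ?enorm_ge0 // enormC ltW.
have lo := prox_minimizer_fin (pr_min yc) fp'.
have hi := prox_minimizer_fin (pr_min yc') fp.
have D1 := divergence3 phi P y' y (pr y).
have D2 := divergence3 phi P y' y (pr y').
have s01 : dot (P (pr y) - P (pr y')) (y' - y) =
    dot (P y - P (pr y')) (y' - y) - dot (P y - P (pr y)) (y' - y).
  by rewrite !dotBl; ring.
have li0 : 0 <= l^-1 by rewrite invr_ge0 ltW.
have -> : e * enorm (y' - y) = l^-1 * (l * e * enorm (y' - y)).
  by rewrite -mulrA mulKf ?gt_eqF.
rewrite s01 ler_norml in Ple; case/andP: Ple => Ple _.
have := ler_wpM2l li0 Dle; have := ler_wpM2l li0 Ple.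
have := mulr_ge0 li0 D0.
move: lo hi; rewrite /envelope D1 D2 dotZl ler_norml => lo hi a b c'.
by apply/andP; split; lra.
Qed.

(** Local coercivity and Lipschitz continuity of [P] turn the left-hand side of
    the monotonicity inequality into a multiple of
    [|P (pr y') - P (pr y)|^2]. *)
Lemma prox_lipschitz d mu L : 0 < c -> 0 < d -> 0 < mu -> 0 < L ->
  (forall x x', enorm (x - pr yb) < d -> enorm (x' - pr yb) < d ->
    enorm (P x' - P x) <= L * enorm (x' - x) /\
    mu * enorm (x' - x) ^+ 2 <= dot (P x' - P x) (x' - x)) ->
  exists K c', 0 < c' /\ forall y y',
    enorm (y - yb) < c' -> enorm (y' - yb) < c' ->
    enorm (P (pr y') - P (pr y)) <= K * enorm (y' - y).
Proof.
move=> c0 d0 mu0 L0 bounds.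
have ybc : enorm (yb - yb) < c by rewrite subrr enorm0.
have [k k0 Pk] := grad_inverse_continuous phiP (pr yb) d0.
have /nbhs_enormP[b b0 prb] := prox_continuous k0 ybc.
have s0 : 0 < (1 - l * r) * mu by rewrite mulr_gt0 // subr_gt0.
exists (L ^+ 2 / ((1 - l * r) * mu)), (Num.min b c).
split=> [|y y']; first by rewrite lt_min b0.
rewrite !lt_min => /andP[/prb/Pk pd yc] /andP[/prb/Pk pd' yc'].
have [lip coer] := bounds _ _ pd pd'; have mono := pr_mono yc yc'.
set w := enorm (P (pr y') - P (pr y)); set a := enorm (pr y' - pr y).
have [w0|] := ltP 0 w; last first.
  move=> /le_trans; apply; rewrite mulr_ge0 ?enorm_ge0 // divr_ge0 ?sqr_ge0 //.
  exact: ltW.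
have aw : (1 - l * r) * mu * a ^+ 2 <= w * enorm (y' - y).
  apply: le_trans (dot_le_enorm _ _); apply: le_trans mono.
  by rewrite -mulrA ler_pM2l // subr_gt0.
have wa : w ^+ 2 <= L ^+ 2 * a ^+ 2.
  by rewrite -exprMn lerXn2r ?nnegrE ?mulr_ge0 ?enorm_ge0 // ltW.
rewrite mulrAC ler_pdivlMr // -(ler_pM2l w0).
have := ler_wpM2l (ltW s0) wa; have := ler_wpM2l (sqr_ge0 L) aw; lra.
Qed.

End Envelope.

(** * Strict differentiability of the gradient *)

Section MatrixBound.
Context {R : realType} {m : nat}.
Implicit Types (u h x y : 'rV[R]_m) (A : 'M[R]_m).

Lemma normr_dot_mulmx_le A h u :
  `|dot (h *m A) u| <= (m * m)%:R * `|A| * enorm h * enorm u.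
Proof.
have term i j : `|h 0 i * A i j * u 0 j| <= `|A| * enorm h * enorm u.
  have Aij : `|A i j| <= `|A|.
    rewrite [leRHS]mx_normrE.
    exact: (le_bigmax _ (fun ij : 'I_m * 'I_m => `|A ij.1 ij.2|) (i, j)).
  rewrite !normrM (mulrC `|A|) !ler_pM ?mulr_ge0 ?coord_le_enorm //.
rewrite dotE.
have -> : \sum_j (h *m A) 0 j * u 0 j = \sum_j \sum_i h 0 i * A i j * u 0 j.
  by apply: eq_bigr => j _; rewrite mxE mulr_suml.
apply: le_trans (ler_norm_sum _ _ _) _.
apply: (@le_trans _ _ (\sum_(j < m) \sum_(i < m) `|A| * enorm h * enorm u)).
  apply: ler_sum => j _; apply: le_trans (ler_norm_sum _ _ _) _.
  by apply: ler_sum => i _.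
by rewrite !sumr_const card_ord -mulrnA -[leLHS]mulr_natl !mulrA.
Qed.

Lemma dot_mulmx_trmx A h u : dot (u *m A^T) h = dot (h *m A) u.
Proof. by rewrite dotC /dot trmx_mul trmxK mulmxA. Qed.

(** By homogeneity it suffices to take the minimum over the unit sphere. *)
Lemma posdef_coercive A : (forall h, h != 0 -> 0 < dot (h *m A) h) ->
  exists2 mu, 0 < mu & forall h, mu * enorm h ^+ 2 <= dot (h *m A) h.
Proof.
move=> Apos.
have [[h0 h00]|none] := pselect (exists h : 'rV[R]_m, h != 0); last first.
  exists 1 => // h; have [->|h0] := eqVneq h 0; last by case: none; exists h.
  by rewrite mul0mx dot0l enorm0 expr0n mulr0.
have unit h : h != 0 -> enorm ((enorm h)^-1 *: h - 0) = 1.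
  by move=> hN; rewrite subr0 enormZ gtr0_norm ?invr_gt0 ?enorm_gt0 //
    mulVf // enorm_eq0.
pose q h := dot (h *m A) h.
have qgrad x : has_grad q x (x *m A + x *m A^T).
  move=> e e0; pose K := (m * m)%:R * `|A| + 1.
  have K0 : 0 < K by rewrite ltr_wpDl // mulr_ge0.
  apply: filterS (near_enorm x (divr_gt0 e0 K0)) => y.
  rewrite ltr_pdivlMr // => yx.
  have -> : q y - q x - dot (x *m A + x *m A^T) (y - x) =
      dot ((y - x) *m A) (y - x).
    by rewrite /q dotDl dot_mulmx_trmx mulmxBl !dotBl !dotBr; ring.
  apply: le_trans (normr_dot_mulmx_le _ _ _) _.
  rewrite ler_wpM2r ?enorm_ge0 //; apply: le_trans (ltW yx).
  by rewrite mulrC ler_wpM2l ?enorm_ge0 // /K lerDl.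
have [|||s] := @EVT_min_rV _ _ q [set h | enorm (h - 0) = 1].
- by exists ((enorm h0)^-1 *: h0); exact: unit.
- exact: compact_esphere.
- by apply: continuous_subspaceT => y; exact: has_grad_continuous (qgrad y).
rewrite inE /= subr0 => s1 smin.
exists (q s).
  by apply: Apos; rewrite -enorm_gt0 s1.
move=> h; have [->|hN] := eqVneq h 0.
  by rewrite mul0mx dot0l enorm0 expr0n mulr0.
have := smin ((enorm h)^-1 *: h); rewrite inE => /(_ (unit h hN)).
rewrite /q -scalemxAl dotZl dotZr mulrA -invfM -expr2 mulrC.
by rewrite ler_pdivlMr // exprn_gt0 // enorm_gt0.
Qed.

End MatrixBound.

Section StrictDifferentiability.
Context {R : realType} {m : nat}.
Implicit Types (u h x y a b : 'rV[R]_m).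

Lemma mean_value_grad (g : 'rV[R]_m -> R) (G : 'rV[R]_m -> 'rV[R]_m) a b :
  (forall x, has_grad g x (G x)) -> exists2 t : R, 0 <= t <= 1 &
    g b - g a = dot (G (a + t *: (b - a))) (b - a).
Proof.
move=> gG; set h := b - a.
pose k t := g (a + t *: h).
have kd (t : R) : is_derive t 1 (k : R -> R^o) (dot (G (a + t *: h)) h).
  set c := dot _ h.
  have lin : linear (fun s : R => s * c : R^o).
    by move=> s t1 t2; rewrite mulrDl scalerAl.
  pose L := GRing.isLinear.Build _ _ _ _ _ lin.
  pose df : {linear R -> R^o} := HB.pack (fun s : R => s * c : R^o) L.
  have dfc : continuous df by move=> s; apply: cvgMl; exact: cvg_id.
  have kdf e : 0 < e ->
      \forall s \near t, `|k s - k t - df (s - t)| <= e * `|s - t|.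
    move=> e0; have h1 : 0 < 1 + enorm h by rewrite ltr_pwDl ?enorm_ge0.
    have [d d0 gd] := has_gradP (gG (a + t *: h)) (divr_gt0 e0 h1).
    have dh := divr_gt0 d0 h1.
    apply/nbhs_ballP; exists (d / (1 + enorm h)) => //= s.
    rewrite -ball_normE /= distrC ltr_pdivlMr // => st.
    have := gd (a + s *: h).
    have -> : a + s *: h - (a + t *: h) = (s - t) *: h.
      by rewrite opprD addrACA subrr add0r scalerBl.
    rewrite enormZ dotZr -/c => /(_ _)/le_trans; apply.
      by apply: le_lt_trans st; rewrite ler_wpM2l // lerDr.
    rewrite mulrCA [leRHS]mulrC ler_wpM2l // mulrAC ler_pdivrMr // ler_pM2l //.
    by rewrite lerDr.
  have [kt dE] := @differential_unique R R R^o k df t dfc kdf.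
  apply: DeriveDef; first exact/derivable1_diffP.
  by rewrite deriveE // dE /df /= mul1r.
have kc : {within `[0, 1], continuous k}.
  apply: continuous_subspaceT => t; apply: differentiable_continuous.
  by apply/derivable1_diffP; case: (kd t).
have [t t01 kE] := MVT ltr01 (fun t _ => kd t) kc.
exists t; first by move: t01; rewrite in_itv /= => /andP[/ltW -> /ltW ->].
by move: kE; rewrite /k scale0r addr0 scale1r subr0 mulr1 /h subrKC.
Qed.

Context (P : 'rV[R]_m -> 'rV[R]_m) (a0 : 'rV[R]_m).
Context (Pd : forall x, differentiable P x)
  (Jc : {for a0, continuous (fun x => 'J P x)}).

(** Scalar components of [P], to which the mean value theorem applies. *)
Lemma component_has_grad u x :
  has_grad (fun y => dot (P y) u) x (u *m ('J P x)^T).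
Proof.
move=> e e0; have u1 : 0 < m.+1%:R * (1 + enorm u).
  by rewrite mulr_gt0 // ltr_pwDl ?enorm_ge0.
apply: filterS (differentiable_near (Pd x) (divr_gt0 e0 u1)) => y.
have -> : 'd P x (y - x) = (y - x) *m 'J P x by rewrite /jacobian mul_rV_lin1.
move=> Py; rewrite dot_mulmx_trmx -!dotBl.
apply: le_trans (normr_dot_le _ _) _.
set w := P y - P x - _ in Py *; set q := e / _ in Py.
have wq : enorm w <= m.+1%:R * (q * enorm (y - x)).
  apply: le_trans (enorm_le_norm _) _; rewrite ler_wpM2l //.
  apply: le_trans Py _; rewrite ler_wpM2l ?norm_le_enorm //.
  by rewrite divr_ge0 // ltW.
apply: le_trans (ler_wpM2r (enorm_ge0 u) wq) _.
have qu : q * (m.+1%:R * enorm u) <= e.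
  rewrite /q mulrAC ler_pdivrMr // ler_pM2l // ler_pM2l //; lra.
have -> : m.+1%:R * (q * enorm (y - x)) * enorm u =
    q * (m.+1%:R * enorm u) * enorm (y - x) by ring.
by rewrite ler_wpM2r ?enorm_ge0.
Qed.

(** Continuity of the derivative at [a0] makes [P] strictly differentiable
    there, so that on a whole ball its increments inherit the boundedness and
    the coercivity of the derivative at the centre. *)
Lemma grad_lipschitz_coercive :
  (forall h, h != 0 -> 0 < dot (h *m 'J P a0) h) ->
  exists d mu L, [/\ 0 < d, 0 < mu, 0 < L & forall x y,
    enorm (x - a0) < d -> enorm (y - a0) < d ->
    enorm (P y - P x) <= L * enorm (y - x) /\
    mu * enorm (y - x) ^+ 2 <= dot (P y - P x) (y - x)].
Proof.
move=> /posdef_coercive[mu mu0 coer].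
set H0 := 'J P a0 in coer.
pose M : R := (m * m)%:R.
have M0 : 0 <= M by rewrite ler0n.
have eps0 : 0 < mu / 2 / (M + 1) by rewrite !divr_gt0 // ltr_wpDl.
have /cvgrPdist_lt/(_ _ eps0)/nbhs_enormP[d d0 Jd] := Jc.
have incr x y u : enorm (x - a0) < d -> enorm (y - a0) < d ->
    `|dot (P y - P x) u - dot ((y - x) *m H0) u| <=
    mu / 2 * enorm (y - x) * enorm u.
  move=> xd yd.
  have [t /andP[t0 t1]] := mean_value_grad x y (component_has_grad u).
  rewrite -dotBl dot_mulmx_trmx => ->; rewrite -dotBl -mulmxBr.
  set z := x + t *: (y - x).
  have zd : enorm (z - a0) < d.
    have -> : z - a0 = (1 - t) *: (x - a0) + t *: (y - a0).
      by apply/rowP => i; rewrite !mxE; ring.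
    apply: le_lt_trans (ler_enormD _ _) _.
    rewrite !enormZ ger0_norm ?subr_ge0 // ger0_norm //.
    move: t0; rewrite le_eqVlt => /orP[/eqP <-|t0].
      by rewrite subr0 mul1r mul0r addr0.
    have : (1 - t) * enorm (x - a0) <= (1 - t) * d.
      by rewrite ler_wpM2l ?subr_ge0 // ltW.
    have : t * enorm (y - a0) < t * d by rewrite ltr_pM2l.
    lra.
  apply: le_trans (normr_dot_mulmx_le _ _ _) _.
  rewrite ler_wpM2r ?enorm_ge0 // ler_wpM2r ?enorm_ge0 // -/M.
  have Jz := ltW (Jd z zd); rewrite -normrN opprB in Jz.
  apply: le_trans (ler_wpM2l M0 Jz) _.
  rewrite mulrCA ler_piMr ?divr_ge0 ?ltW // ltr_pdivrMr ?ltr_wpDl //.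
  by rewrite mul1r ltrDl.
exists d, (mu / 2), (M * `|H0| + mu); split => //.
- by rewrite divr_gt0.
- by rewrite ltr_wpDl // mulr_ge0.
move=> x y xd yd; split; last first.
  have := incr x y (y - x) xd yd.
  rewrite ler_norml -mulrA -expr2 => /andP[lo _].
  by have := coer (y - x); lra.
have [->|w0] := eqVneq (P y - P x) 0.
  rewrite enorm0 mulr_ge0 ?enorm_ge0 // addr_ge0 ?mulr_ge0 //; exact: ltW.
have w1 : 0 < enorm (P y - P x) by rewrite enorm_gt0.
rewrite -(ler_pM2r w1) -expr2 enorm_sqr.
have := incr x y (P y - P x) xd yd; rewrite ler_norml => /andP[_ hi].
have := normr_dot_mulmx_le H0 (y - x) (P y - P x); rewrite -/M.
rewrite ler_norml => /andP[_ hi2].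
have := mulr_ge0 (ltW mu0) (mulr_ge0 (enorm_ge0 (y - x)) (ltW w1)); nra.
Qed.

End StrictDifferentiability.

(** * Proximal problems in extended real form *)

Section Bridge.
Context {R : realType} {m : nat}.
Context (phi : 'rV[R]_m -> \bar R) (phir : 'rV[R]_m -> R).
Context (P : 'rV[R]_m -> 'rV[R]_m).
Context (phiE : forall x, phi x = (phir x)%:E).
Context (phiP : strictly_convex_with_grad phir P).
Context (f : 'rV[R]_m -> \bar R) (l : R).
Context (f_gtNy : forall x, (-oo < f x)%E) (l0 : 0 < l).
Implicit Types (x y p z : 'rV[R]_m) (g : 'rV[R]_m -> \bar R).

Local Notation D := (divergence phir P).

Lemma argminP g p : argmin g p <-> (g p < +oo)%E /\ forall x, (g p <= g x)%E.
Proof.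
split=> [[gp ginf]|[gp gmin]]; split=> //.
  by move=> x; rewrite ginf; apply: ereal_inf_lbound; exists x.
apply/le_anti/andP; split; last by apply: ereal_inf_lbound; exists p.
by apply/ereal_infP => _ [x _ <-].
Qed.

Lemma right_objectiveE y x :
  (f x + (l^-1)%:E * bregman phi y x = f x + (l^-1 * D y x)%:E)%E.
Proof. by rewrite (bregmanE phiE phiP). Qed.

Lemma right_proxP y p :
  right_prox phi l f y p <-> prox_minimizer phir P f l y p.
Proof.
rewrite prox_minimizerP // /right_prox argminP right_objectiveE.
by split=> -[pfin pmin]; split=> // x; have := pmin x; rewrite right_objectiveE.
Qed.

Lemma right_env_minimizer y p : prox_minimizer phir P f l y p ->
  right_env phi l f y = (fine (f p) + l^-1 * D y p)%:E.
Proof.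
move=> pmin; have [fp _] := pmin.
move: pmin => /right_proxP[_ inf]; rewrite /right_env -inf right_objectiveE.
by rewrite EFinD fineK.
Qed.

(** Conjugate duality of Bregman distances: at the point [P x] the left problem
    has the same objective as the right problem at [x]. *)
Lemma left_objectiveE y x :
  (comp_grad_conj f phi (P x) +
    (l^-1)%:E * bregman (convex_conj phi) (P x) (P y) =
   f x + (l^-1 * D y x)%:E)%E.
Proof. by rewrite (comp_grad_conjE phiE phiP) (bregman_conj phiE phiP). Qed.

Lemma left_objective_out y z : (forall x, P x <> z) ->
  (comp_grad_conj f phi z + (l^-1)%:E * bregman (convex_conj phi) z (P y) =
   +oo)%E.
Proof.
move=> zN; rewrite (comp_grad_conj_out phiE phiP) // addye // gt_eqF //.
have := bregman_conj_gtNy phiE phiP z y.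
case: (bregman _ z _) => [b||] // _; first by rewrite -EFinM ltNyr.
by rewrite gt0_muley // lte_fin invr_gt0.
Qed.

Lemma left_proxP y z :
  left_prox (convex_conj phi) l (comp_grad_conj f phi) (P y) z <->
  exists2 p, z = P p & prox_minimizer phir P f l y p.
Proof.
rewrite /left_prox argminP; split=> [[zfin zmin]|[p -> /prox_minimizerP]].
  have [[p pz]|zN] := pselect (exists p, P p = z); last first.
    by move: zfin; rewrite left_objective_out // => x xz; apply: zN; exists x.
  exists p; first by rewrite pz.
  apply/(prox_minimizerP phir P f_gtNy); split=> [|x].
    by move: zfin; rewrite -pz left_objectiveE.
  by rewrite -(left_objectiveE y p) -(left_objectiveE y x) pz.
move=> /(_ f_gtNy)[pfin pmin]; split=> [|w]; first by rewrite left_objectiveE.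
have [[x <-]|wN] := pselect (exists x, P x = w).
  by have := pmin x; rewrite -(left_objectiveE y p) -(left_objectiveE y x).
have {}wN x : P x <> w by move=> xw; apply: wN; exists x.
by apply: le_trans (leey _) _; rewrite (left_objective_out y wN).
Qed.

End Bridge.

(** * Smoothness of the right envelope *)

Unset Implicit Arguments.

Theorem corollary3p35 (R : realType) (m : nat)
    (phi f : 'rV[R]_m -> \bar R) (xbar vbar : 'rV[R]_m)
    (phi_legendre : legendre phi) (phi_dom : edom phi = setT)
    (f_proper : eproper f) (f_lsc : lower_semicontinuous f)
    (f_prox_bounded : right_prox_bounded phi f)
    (xbar_dom : edom f xbar)
    (f_prox_regular : prox_regular (convex_conj phi) (comp_grad_conj f phi)
                        (grad phi xbar) vbar) :
  exists2 l0 : R, 0 < l0 &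
  forall l : R, 0 < l -> (l%:E < prox_threshold phi f)%E -> l < l0 ->
  let ybar := xbar + l *: vbar in
  let env := right_env phi l f in
  [/\ C1_around env ybar,
      (\forall y \near ybar, exists p q : 'rV[R]_m,
        [/\ right_prox phi l f y = [set p],
            left_prox (convex_conj phi) l (comp_grad_conj f phi) (grad phi y)
              = [set q],
            grad env y = l^-1 *: (grad phi y - grad phi p) &
            grad env y = l^-1 *: (grad phi y - q)]) &
      (very_strictly_convex phi -> lipschitz_around (grad env) ybar)].
Proof.
have [P PE] : exists P, P = grad phi by exists (grad phi).
have [F FE] : exists F, F = comp_grad_conj f phi.
  by exists (comp_grad_conj f phi).
have phiE := legendre_fin phi_legendre phi_dom.
have := legendre_strictly_convex phi_legendre phi_dom.
rewrite -PE in f_prox_regular *; move=> phiP.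
have [_ f_gtNy] := f_proper.
have fxb : f xbar \is a fin_num by rewrite fin_numElt f_gtNy; exact: xbar_dom.
have FP x : F (P x) = f x by rewrite FE; exact: comp_grad_conjE.
have rangeP := near_grad_range phiE phiP.
rewrite -FE in f_prox_regular.
have [_ _ _ vsub [e [r [e0 r0 _ reg]]]] := f_prox_regular.
have freg x p w : enorm (P x - P xbar) < e -> enorm (P p - P xbar) < e ->
    (f p - f xbar < e%:E)%E -> limiting_subdiff F (P p) w ->
    enorm (w - vbar) < e ->
    (f p + (dot w (P x - P p) -
            r * divergence (fine \o phi) P p x)%:E <= f x)%E.
  move=> xe pe fpe wsub we; have := reg (P x) (P p) w xe pe.
  rewrite !FP (bregman_conj phiE phiP) -EFinM -addeA -EFinN -EFinD.
  by move=> /(_ fpe wsub we).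
have local x : enorm (P x - P xbar) < e ->
    (f xbar + (dot vbar (P x - P xbar) -
               r * divergence (fine \o phi) P xbar x)%:E <= f x)%E.
  by move=> xe; apply: freg; rewrite ?subrr ?enorm0 ?subee.
have [_ [l1 [l10 [y0 _ envNy]]]] := f_prox_bounded.
have [c0 _ c0inf] := ereal_between envNy.
have global x :
    ((c0 - l1^-1 * divergence (fine \o phi) P y0 x)%:E <= f x)%E.
  rewrite EFinB leeBlDr // -(right_objectiveE phiE phiP).
  by apply: le_trans (ltW c0inf) _; apply: ereal_inf_lbound; exists x.
have [l0 l00 main] := prox_growth phiP fxb e0 r0 l10 local global.
exists l0 => // l lpos _ /(main l lpos)[lr1 growth] ybar env.
have [pr [c [cpos pr_min pr_uniq pr_mono]]] :=
  prox_map phiP f_gtNy f_lsc lpos (erefl ybar) fxb growth FP rangeP e0 lr1 freg.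
pose E := envelope (fine \o phi) P f l pr.
have split_diff (a b a' b' : 'rV[R]_m) :
    a - b - (a' - b') = (a - a') - (b - b').
  by apply/rowP => i; rewrite !mxE; ring.
have ybarc : enorm (ybar - ybar) < c by rewrite subrr enorm0.
have envE y : enorm (y - ybar) < c -> env y = (E y)%:E.
  by move=> /pr_min pmin; exact: right_env_minimizer.
have env_diff y : enorm (y - ybar) < c ->
    ediff env y /\ grad env y = l^-1 *: (P y - P (pr y)).
  move=> yc; apply: (ediffE (h := E)).
    by apply: filterS (near_in_ball yc) => y' /envE.
  exact: (envelope_has_grad phiP lpos lr1 pr_min pr_mono yc).
split.
- apply: filterS (near_in_ball ybarc) => y yc; split.
    exact: (proj1 (env_diff y yc)).
  apply/(@cvg_enormP _ _ _ (nbhs y)) => a a0.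
  have la0 : 0 < l * a / 2 by rewrite divr_gt0 // mulr_gt0.
  have Pnear : \forall y' \near y, enorm (P y' - P y) < l * a / 2.
    by have /cvg_enormP := @grad_continuous _ _ _ _ phiP y; apply.
  apply: filterS3 (near_in_ball yc) Pnear
    (prox_continuous phiP lr1 pr_mono la0 yc) => y' yc' Py Ppr.
  rewrite (proj2 (env_diff _ yc)) (proj2 (env_diff _ yc')) -scalerBr.
  rewrite enormZ gtr0_norm ?invr_gt0 // mulrC ltr_pdivrMr // mulrC.
  rewrite split_diff; apply: le_lt_trans (ler_enormD _ _) _.
  rewrite enormN; lra.
- apply: filterS (near_in_ball ybarc) => y yc.
  have [_ dE] := env_diff y yc; have pmin := pr_min y yc.
  exists (pr y), (P (pr y)); split=> //.
    apply/seteqP; split=> [p /(right_proxP phiE phiP l f_gtNy)|_ ->].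
      exact: pr_uniq.
    exact/(right_proxP phiE phiP l f_gtNy).
  apply/seteqP; split=> [z|_ ->].
    by move=> /(left_proxP phiE phiP f_gtNy lpos)[p -> /pr_uniq ->].
  by apply/(left_proxP phiE phiP f_gtNy lpos); exists (pr y).
- move=> [_ vsc].
  have Pvsc x : [/\ differentiable P x, {for x, continuous (hess phi)} &
      forall w : 'rV[R]_m, w != 0 -> 0 < dot (w *m hess phi x) w].
    have [|_ ? ? ?] := vsc x; first by rewrite phi_dom interiorT.
    by rewrite PE.
  have hessE : hess phi = (fun x => 'J P x) by rewrite PE.
  have Pd x : differentiable P x by case: (Pvsc x).
  have loc x : exists d mu L, [/\ 0 < d, 0 < mu, 0 < L & forall y y',
      enorm (y - x) < d -> enorm (y' - x) < d ->
      enorm (P y' - P y) <= L * enorm (y' - y) /\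
      mu * enorm (y' - y) ^+ 2 <= dot (P y' - P y) (y' - y)].
    by have [_ Jc pos] := Pvsc x; rewrite hessE in Jc pos;
      exact: grad_lipschitz_coercive.
  have [d1 [mu [L1 [d10 mu0 L10 bounds]]]] := loc (pr ybar).
  have [d2 [mu2 [L2 [d20 _ _ lip]]]] := loc ybar.
  have [K [b [b0 prlip]]] :=
    prox_lipschitz phiP lr1 pr_mono cpos d10 mu0 L10 bounds.
  exists [set y | enorm (y - ybar) < Num.min c (Num.min d2 b)].
    by apply: near_enorm; rewrite !lt_min cpos d20.
  exists (l^-1 * (L2 + K)) => y z; rewrite /= !lt_min.
  move=> /and3P[yc yd yb] /and3P[zc zd zb].
  rewrite (proj2 (env_diff _ yc)) (proj2 (env_diff _ zc)) -scalerBr.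
  have li0 : 0 < l^-1 by rewrite invr_gt0.
  rewrite enormZ (gtr0_norm li0) -mulrA (ler_pM2l li0).
  rewrite split_diff mulrDl; apply: le_trans (ler_enormD _ _) _.
  rewrite enormN; apply: lerD; last exact: prlip.
  by case: (lip z y zd yd).
Qed.
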